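(* Let $f \in L^2(\mathbb{R})$ with $\mathrm{supp}(\widehat{f}\,) \subset [-\tfrac12, \tfrac12]$. Then $$\int_{-\infty}^{\infty} |f(x)|^2 \, dx \leq \int_{-\infty}^{\infty} |f(x)|^2 \, x^6\, dx.$$ This inequality is sharp and the unique extremizer (up to multiplication by a complex constant) is $$f(x) = \frac{(x^2-1)\coth\big(\tfrac{\pi \sqrt{3}}{2}\big) \cos \pi x - \sqrt{3}\,x \sin \pi x}{x^6-1}.$$
   Context: The Fourier transform is normalized by $\widehat{f}(\xi)=\int_{\mathbb{R}}e^{-2\pi i x \xi} f(x)\,dx$ for $f \in L^1(\mathbb{R})$, extended to $L^2(\mathbb{R})$ as usual. The right-hand side of the inequality may be $+\infty$. An extremizer is a nonzero $f\in L^2(\mathbb{R})$ with $\mathrm{supp}(\widehat f\,)\subset[-\frac12,\frac12]$ for which equality holds. The displayed formula for $f$ is understood by continuous extension at the removable singularities $x=\pm 1$. *)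

(* Defs.v *)
From HB Require Import structures.
From mathcomp Require Export all_boot all_order all_algebra.
From mathcomp Require Export all_classical all_reals all_analysis.
From mathcomp Require Export complex.

Set Implicit Arguments.
Unset Strict Implicit.
Unset Printing Implicit Defensive.

Export Order.TTheory GRing.Theory Num.Theory numFieldNormedType.Exports.

Global Open Scope classical_set_scope.
Global Open Scope ring_scope.
Global Open Scope complex_scope.

Notation normc := ComplexField.Normc.normc.

Notation leb R := (@lebesgue_measure R).

(* A function is a representative of its class in L^p; Borel measurability
   loses nothing, since every Lebesgue class has a Borel representative. *)
Definition cmeasurable (R : realType) (f : R -> R[i]) : Prop :=
  measurable_fun [set: R] (fun x => complex.Re (f x)) /\
  measurable_fun [set: R] (fun x => complex.Im (f x)).

Definition cLnorm (R : realType) (p : \bar R) (f : R -> R[i]) : \bar R :=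
  Lnorm (leb R) p (fun x => (normc (f x))%:E).

Definition memL (R : realType) (p : \bar R) (f : R -> R[i]) : Prop :=
  cmeasurable f /\ (cLnorm p f < +oo)%E.

Definition cintegral (R : realType) (f : R -> R[i]) : R[i] :=
  Rintegral (leb R) [set: R] (fun x => complex.Re (f x)) +i*
  Rintegral (leb R) [set: R] (fun x => complex.Im (f x)).

Definition expi (R : realType) (t : R) : R[i] := cos t +i* sin t.

Definition fourierL1 (R : realType) (f : R -> R[i]) (xi : R) : R[i] :=
  cintegral (fun x => expi (- (2 * pi * x * xi)) * f x).

(* [g] represents the L^2 Fourier transform of [f]: the extension by continuity
   of [fourierL1] from L^1 `&` L^2, given by its graph.  By Plancherel such a [g]
   exists for every [f] in L^2, is unique up to a null set, and does not depend
   on the approximating sequence. *)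
Definition is_fourierL2 (R : realType) (f g : R -> R[i]) : Prop :=
  [/\ memL 2%:E f, memL 2%:E g &
      exists u : nat -> R -> R[i],
        [/\ forall n, memL 1%:E (u n) /\ memL 2%:E (u n),
            (fun n => cLnorm 2%:E (fun x => u n x - f x)) @ \oo --> 0%E &
            (fun n => cLnorm 2%:E (fun xi => fourierL1 (u n) xi - g xi)) @ \oo
              --> 0%E]].

(* Support of an a.e. class: the complement of the union of all open sets on
   which the function vanishes almost everywhere. *)
Definition ess_supp (R : realType) (g : R -> R[i]) : set R :=
  ~` \bigcup_(U in [set U : set R | open U /\
                      {ae leb R, forall x, U x -> g x = 0}]) U.

Definition bandlimited (R : realType) (f : R -> R[i]) : Prop :=
  exists2 g, is_fourierL2 f g & ess_supp g `<=` `[- (1 / 2), 1 / 2].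

Definition extremizer (R : realType) (f : R -> R[i]) : Prop :=
  [/\ memL 2%:E f, bandlimited f,
      ~ {ae leb R, forall x, f x = 0} &
      (\int[leb R]_x (normc (f x) ^+ 2)%:E
         = \int[leb R]_x (normc (f x) ^+ 2 * x ^+ 6)%:E)%E].

Definition coth (R : realType) (t : R) : R :=
  (expR t + expR (- t)) / (expR t - expR (- t)).

Definition extremal_quotient (R : realType) (x : R) : R :=
  ((x ^+ 2 - 1) * coth (pi * Num.sqrt 3 / 2) * cos (pi * x)
     - Num.sqrt 3 * x * sin (pi * x)) / (x ^+ 6 - 1).

(* The quotient takes the library's value of division by 0 at 1 and -1, so
   there the limit over punctured neighbourhoods is used instead. *)
Definition extremal_fun (R : realType) (x : R) : R[i] :=
  (if x ^+ 6 == 1 then lim (extremal_quotient y @[y --> x^'])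
   else extremal_quotient x)%:C.

(* Main.v *)
(** Let [Q u] be the integral of [(x^6 - 1) |u|^2].  If it is finite, then [u], [x u] and
    [x^2 u] are integrable, so the Fourier transform of [u] is of class C^2, supported in
    [[-1/2, 1/2]], and vanishes to second order at the endpoints.  For the extremal function
    [e], [(x^6 - 1) e] is a combination of [x^2 cos (pi x)], [cos (pi x)] and [x sin (pi x)],
    hence orthogonal to every such [u], and to [e] itself: [e] lies in the radical of the
    form.  Thus [Q u = Q (u - c e)], and [c] can be chosen so that the Fourier transform of
    [h = u - c e] has mean zero (that is, [h 0 = 0]).  Since [x^6 - 1 >= 3 (x^2 - 1)] with
    equality only at [x = 1] and [x = -1], it suffices that [(x^2 - 1) |h|^2] has a
    nonnegative integral.  By Plancherel this is Wirtinger's inequality on [[0, pi]], applied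
    to the odd part of the transform, which vanishes at both ends, and to the even part, which
    vanishes at [pi] and has mean zero.  Real and imaginary parts are treated separately. *)

Require Import Defs.
From mathcomp Require Import measurable_realfun ring lra.

Set Implicit Arguments.
Unset Strict Implicit.
Unset Printing Implicit Defensive.

(** Frequencies are taken angular, w = 2 pi xi. The band becomes [-pi, pi], and Wirtinger's constant
    on [0, pi] is exactly 1, the constant in x^2 - 1: there is no slack. On the transform side x^6 -
    1 acts as -(d/dw)^6 - 1, so stationarity reads G^(6) = - G on the band, with triple zeros at its
    ends. The function e is the cosine transform of the even solution G cut off outside the band;
    conversely, Fourier inversion recovers G from e, which gives both the band limitation of e and
    the nonzero mean that fixes c. The same inversion yields Plancherel. The obstacle is that
    [bandlimited] speaks of an L^2 limit and of an almost everywhere support, whereas the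
    orthogonality needs values of the transform and its derivatives at pi itself. Finiteness of the
    weighted integral makes f integrable, so its classical transform is continuous. Integrating that
    transform over small intervals outside the band shows that it vanishes there, and continuity
    carries this to the endpoints. *)

Lemma ae_imp (R : realType) (P Q : R -> Prop) : (forall x, P x -> Q x) ->
  {ae leb R, forall x, P x} -> {ae leb R, forall x, Q x}.
Proof. by move=> PQ; apply: filterS; first exact: (ae_filter_ringOfSetsType (leb R)). Qed.

Lemma ae_and (R : realType) (P Q : R -> Prop) :
  {ae leb R, forall x, P x} -> {ae leb R, forall x, Q x} ->
  {ae leb R, forall x, P x /\ Q x}.
Proof. by move=> aP aQ; apply: filterI => //; exact: (ae_filter_ringOfSetsType (leb R)). Qed.

(** * Integrable functions and trigonometric transforms *)

Section L1.
Context (R : realType).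
Implicit Types (f g k p : R -> R) (M c : R).

Definition L1 f := (leb R).-integrable [set: R] (EFin \o f).

Lemma L1_measurable f : L1 f -> measurable_fun [set: R] f.
Proof. by move=> /integrableP[/measurable_EFinP]. Qed.

Lemma L1_le f g : measurable_fun [set: R] f -> L1 g ->
  (forall x, `|f x| <= g x) -> L1 f.
Proof.
move=> mf Lg fg; apply: (le_integrable measurableT _ _ Lg).
  exact/measurable_EFinP.
by move=> x _ /=; rewrite lee_fin (le_trans (fg x))// ler_norm.
Qed.

Lemma L1D f g : L1 f -> L1 g -> L1 (fun x => f x + g x).
Proof. by move=> Lf Lg; exact: (integrableD measurableT Lf Lg). Qed.

Lemma L1Z c f : L1 f -> L1 (fun x => c * f x).
Proof. by move=> Lf; exact: (integrableZl measurableT c Lf). Qed.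

Lemma L1B f g : L1 f -> L1 g -> L1 (fun x => f x - g x).
Proof. by move=> Lf Lg; exact: (integrableB measurableT Lf Lg). Qed.

Lemma L1_norm f : L1 f -> L1 (fun x => `|f x|).
Proof. by move=> /integrable_norm. Qed.

Lemma L1M_bounded M f k : L1 f -> measurable_fun [set: R] k ->
  (forall x, `|k x| <= M) -> L1 (fun x => f x * k x).
Proof.
move=> Lf mk kM; apply: (L1_le _ (L1Z M (L1_norm Lf))).
  by apply: measurable_funM => //; exact: L1_measurable.
by move=> x; rewrite normrM mulrC ler_wpM2r.
Qed.

Lemma L1_mkcond D f : measurable D ->
  (leb R).-integrable D (EFin \o f) -> L1 (f \_ D).
Proof.
move=> mD fD; rewrite /L1 -restrict_EFin.
by apply/integrable_restrict => //; rewrite setTI.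
Qed.

Lemma L1_restrict D f : measurable D -> L1 f -> L1 (f \_ D).
Proof.
by move=> mD fD; apply: L1_mkcond => //; exact: integrableS fD.
Qed.

Lemma Rintegral_dominated M f (k : R -> R) (k_ : nat -> R -> R) : L1 f ->
  (forall n, measurable_fun [set: R] (k_ n)) -> measurable_fun [set: R] k ->
  (forall n x, `|k_ n x| <= M) ->
  {ae leb R, forall x, k_ n x @[n --> \oo] --> k x} ->
  \int[leb R]_x (f x * k_ n x) @[n --> \oo] --> \int[leb R]_x (f x * k x).
Proof.
move=> Lf mk_ mk kM kcvg; have mf := L1_measurable Lf.
have [] := @dominated_convergence _ _ _ (leb R) setT measurableT
  (fun n x => (f x * k_ n x)%:E) (fun x => (f x * k x)%:E)
  (fun x => (M * `|f x|)%:E).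
- by move=> n; apply/measurable_EFinP; apply: measurable_funM; [exact: mf|exact: mk_].
- by apply/measurable_EFinP; apply: measurable_funM; [exact: mf|exact: mk].
- apply: ae_imp kcvg => x kx _; apply: cvg_EFin; first exact: nearW.
  by apply: cvgM => //; exact: cvg_cst.
- exact: (L1Z M (L1_norm Lf)).
- by apply: aeW => x n _; rewrite lee_fin normrM mulrC ler_wpM2r.
move=> Lfk _ H; apply: fine_cvg; rewrite fineK//.
exact: integrable_fin_num.
Qed.

(** The double integrand is dominated by [M] times the tensor product of |f| and |p|, which is
    integrable on the plane. This is the exchange behind Poisson smoothing, Plancherel and the tests
    on intervals. *)
Lemma Fubini_kernel M f p (k : R * R -> R) : L1 f -> L1 p ->
  measurable_fun [set: R * R] k -> (forall z, `|k z| <= M) ->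
  \int[leb R]_y (p y * \int[leb R]_x (f x * k (x, y))) =
  \int[leb R]_x (f x * \int[leb R]_y (p y * k (x, y))).
Proof.
move=> Lf Lp mk kM; have mf := L1_measurable Lf; have mp := L1_measurable Lp.
pose F (z : R * R) := (f z.1 * p z.2 * k z)%:E.
have mF : measurable_fun setT F.
  apply/measurable_EFinP/measurable_funM => //.
  by apply: measurable_funM; [exact: measurableT_comp|exact: measurableT_comp].
have M0 : 0 <= M by apply: le_trans (kM (0, 0)).
have iF : (leb R \x leb R)%E.-integrable setT F.
  have iG : (leb R \x leb R)%E.-integrable setT
      (fun z : R * R => (M * (f z.1 * p z.2))%:E).
    apply/integrable12ltyP => //.
      apply/measurable_EFinP/measurable_funM => //.
      by apply: measurable_funM; [exact: measurableT_comp|exact: measurableT_comp].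
    have E x : (\int[leb R]_y `|(M * (f x * p y))%:E| =
        ((\int[leb R]_x0 `|p x0|) * (M * `|f x|))%:E)%E.
      transitivity (\int[leb R]_y ((M * `|f x|)%:E * `|p y|%:E))%E.
        by apply: eq_integral => y _; rewrite /= !normrM (ger0_norm M0) mulrA EFinM.
      rewrite integralZl//=; last exact: L1_norm Lp.
      rewrite (_ : integral _ _ _ = (\int[leb R]_y `|p y|)%:E).
        by rewrite -EFinM mulrC.
      by rewrite /Rintegral fineK//; exact: integrable_fin_num (L1_norm Lp).
    under eq_integral do rewrite /= E.
    apply: integrable_lty => //; exact: (L1Z (\int[leb R]_x0 `|p x0|) (L1Z M (L1_norm Lf))).
  apply: le_integrable iG => //.
  move=> z _ /=; rewrite lee_fin normrM [leRHS]normrM (ger0_norm M0) mulrC.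
  by rewrite ler_wpM2r.
have := Fubini iF.
rewrite /F /= => FF.
rewrite [in LHS]/Rintegral [in RHS]/Rintegral; congr fine.
transitivity (\int[leb R]_y \int[leb R]_x (f x * p y * k (x, y))%:E)%E.
  apply: eq_integral => y _.
  have Lk : L1 (fun x => f x * k (x, y)).
    apply: (@L1M_bounded M) => //.
    by apply: measurableT_comp => //; exact: measurable_pair2.
  rewrite -RintegralZl// /Rintegral fineK; last first.
    exact: (integrable_fin_num measurableT (L1Z (p y) Lk)).
  by apply: eq_integral => x _; rewrite mulrCA mulrA.
rewrite -FF; apply: eq_integral => x _.
have Lk : L1 (fun y => p y * k (x, y)).
  apply: (@L1M_bounded M) => //.
  by apply: measurableT_comp => //; exact: measurable_pair1.
rewrite -RintegralZl// /Rintegral fineK; last first.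
  exact: (integrable_fin_num measurableT (L1Z (f x) Lk)).
by apply: eq_integral => y _; rewrite mulrA.
Qed.

Lemma Rintegral_norm_le f k : L1 f -> measurable_fun [set: R] k ->
  (forall x, `|k x| <= 1) -> `|\int[leb R]_x (f x * k x)| <= \int[leb R]_x `|f x|.
Proof.
move=> Lf mk k1; have Lfk := L1M_bounded Lf mk k1.
apply: (le_trans (le_normr_Rintegral measurableT Lfk)).
apply: le_Rintegral => //; [exact: L1_norm Lfk|exact: L1_norm|].
by move=> x _; rewrite normrM ler_piMr.
Qed.

Section trig_transform.
Context (k dk : R -> R).
Hypotheses (dk1 : forall t : R, is_derive t (1 : R) k (dk t))
  (k_le1 : forall t, `|k t| <= 1) (dk_le1 : forall t, `|dk t| <= 1).

Let kcont : continuous k.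
Proof.
move=> t; apply/differentiable_continuous/derivable1_diffP.
exact: (@ex_derive _ _ _ _ _ _ _ (dk1 t)).
Qed.

Let mk w : measurable_fun [set: R] (fun x => k (w * x)).
Proof.
apply: continuous_measurable_fun => x.
apply: continuous_comp; last exact: kcont.
by apply: continuousM; [exact: cst_continuous|exact: id].
Qed.

Definition ttrans f w := \int[leb R]_x (f x * k (w * x)).

Lemma ttrans_continuous f : L1 f -> continuous (ttrans f).
Proof.
move=> Lf w; have mf := L1_measurable Lf.
have := @continuity_under_integral R _ _ (leb R) (fun v x => f x * k (v * x))
  setT measurableT (w - 1) (w + 1) _ _ (fun x => `|f x|) (L1_norm Lf) _.
apply.
- by move=> v _; exact: (L1M_bounded Lf (mk v) (fun x => k_le1 _)).
- apply: aeW => x _ v _; apply: continuousM; first exact: cst_continuous.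
  apply: continuous_comp; last exact: kcont.
  by apply: continuousM; [exact: id|exact: cst_continuous].
- by move=> v _; apply: aeW => x _; rewrite normrM ler_piMr.
- by rewrite inE /= in_itv /=; apply/andP; split; lra.
Qed.

(** Differentiation under the integral: as |dk| <= 1, the derivative in w is dominated by |x f(x)|,
    uniformly in w. *)
Lemma is_derive_ttrans f w : L1 f -> L1 (fun x => x * f x) ->
  is_derive w (1 : R) (ttrans f) (\int[leb R]_x (x * f x * dk (w * x))).
Proof.
move=> Lf Lxf.
have dE v x : is_derive v (1 : R) (fun v => f x * k (v * x)) (x * f x * dk (v * x)).
  have dvx : is_derive v (1 : R) (fun v => v * x) x.
    by apply: is_derive_eq; rewrite scaler0 add0r /GRing.scale /= mulr1.
  have dkv : is_derive (v * x) (1 : R) k (dk (v * x)) by [].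
  have H := @is_derive1_comp _ k (fun v : R => v * x) v _ _ dkv dvx.
  have := @is_deriveZ _ _ _ _ (f x) _ _ _ H.
  by move=> {}H; apply: is_derive_eq; rewrite /GRing.scale /=; ring.
have I0 : `]w - 1, w + 1[%classic w by rewrite /= in_itv /=; apply/andP; split; lra.
have intf v : `]w - 1, w + 1[%classic v ->
    (leb R).-integrable setT (EFin \o (fun x => f x * k (v * x))).
  by move=> _; exact: (L1M_bounded Lf (mk v) (fun x => k_le1 _)).
have derf v x : `]w - 1, w + 1[%classic v -> setT x ->
    derivable ((fun v x => f x * k (v * x)) ^~ x) v 1.
  by move=> _ _; exact: (@ex_derive _ _ _ _ _ _ _ (dE v x)).
have d1E v x : partial1of2 (fun v x => f x * k (v * x)) v x = x * f x * dk (v * x).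
  by rewrite partial1of2E; apply: derive_val.
have G0 x : setT x -> 0 <= `|x * f x| by [].
have Gub v x : `]w - 1, w + 1[%classic v -> setT x ->
    `|partial1of2 (fun v x => f x * k (v * x)) v x| <= `|x * f x|.
  by move=> _ _; rewrite d1E normrM ler_piMr.
have D := derivable_under_integral measurableT I0 intf derf
  (fun x => normr_ge0 _) (L1_norm Lxf) Gub.
have E := differentiation_under_integral measurableT I0 intf derf
  (fun x => normr_ge0 _) (L1_norm Lxf) Gub.
apply: DeriveDef; first exact: D.
rewrite -derive1E [LHS]E; apply: eq_Rintegral => x _; exact: d1E.
Qed.

End trig_transform.

Lemma Rintegral_FTC (f F : R -> R) (a b : R) : a <= b ->
  (forall x : R, is_derive x (1 : R) F (f x)) -> continuous f ->
  \int[leb R]_(x in `[a, b]) f x = F b - F a.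
Proof.
rewrite le_eqVlt => /predU1P[<-|ab] dF cf.
  by rewrite set_itv1 Rintegral_set1 subrr.
have cF x : {for x, continuous F}.
  by apply/differentiable_continuous/derivable1_diffP; exact: (@ex_derive _ _ _ _ _ _ _ (dF x)).
rewrite /Rintegral (@continuous_FTC2 _ f F)//.
- exact: continuous_subspaceT.
- split; first by move=> x _; exact: (@ex_derive _ _ _ _ _ _ _ (dF x)).
  + by apply: cvg_at_right_filter; exact: cF.
  + by apply: cvg_at_left_filter; exact: cF.
- by move=> x _; rewrite derive1E; apply: derive_val.
Qed.

Lemma L1_continuous_itv (f : R -> R) (a b : R) : continuous f -> L1 (f \_ `[a, b]).
Proof.
move=> cf; apply: L1_mkcond => //; apply: continuous_compact_integrable.
  exact: segment_compact.
exact: continuous_subspaceT.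
Qed.

End L1.

(** * Derivatives of explicit real functions *)

Section deriv.
Context (R : realType).
Implicit Types (f g : R -> R) (x a b c : R).

Lemma deriv_conv f x a b : is_derive x (1 : R) f a -> a = b -> is_derive x (1 : R) f b.
Proof. by move=> + <-. Qed.

Lemma deriv_cst c x : is_derive x (1 : R) (fun=> c) 0.
Proof. exact: is_derive_cst. Qed.

Lemma deriv_id x : is_derive x (1 : R) (fun y : R => y) 1.
Proof. exact: is_derive_id. Qed.

Lemma derivD f g x a b : is_derive x (1 : R) f a -> is_derive x (1 : R) g b ->
  is_derive x (1 : R) (fun y => f y + g y) (a + b).
Proof. by move=> df dg; exact: is_deriveD. Qed.

Lemma derivN f x a : is_derive x (1 : R) f a ->
  is_derive x (1 : R) (fun y => - f y) (- a).
Proof. by move=> df; exact: is_deriveN. Qed.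

Lemma derivM f g x a b : is_derive x (1 : R) f a -> is_derive x (1 : R) g b ->
  is_derive x (1 : R) (fun y => f y * g y) (a * g x + f x * b).
Proof.
move=> df dg; apply: (deriv_conv (is_deriveM df dg)).
by rewrite /GRing.scale /= addrC; congr (_ + _); rewrite mulrC.
Qed.

Lemma deriv_comp f df g x b : (forall t : R, is_derive t (1 : R) f (df t)) ->
  is_derive x (1 : R) g b -> is_derive x (1 : R) (fun y => f (g y)) (df (g x) * b).
Proof. by move=> Hf Hg; exact: (is_derive1_comp (Hf (g x)) Hg). Qed.

Lemma deriv_continuous f df : (forall t : R, is_derive t (1 : R) f (df t)) ->
  continuous f.
Proof.
move=> H t; apply/differentiable_continuous/derivable1_diffP.
exact: (@ex_derive _ _ _ _ _ _ _ (H t)).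
Qed.

Definition deriv_cos := fun g x b => @deriv_comp cos _ g x b (@is_derive_cos R).
Definition deriv_sin := fun g x b => @deriv_comp sin _ g x b (@is_derive_sin R).
Definition deriv_expR := fun g x b => @deriv_comp expR _ g x b (@is_derive_expR R).
Definition deriv_atan := fun g x b => @deriv_comp atan _ g x b (@is_derive1_atan R).

End deriv.

(** The derivative is left as an existential variable and found by following the syntax; what
    remains is the equation between the value found and the value claimed. [eassumption] brings in
    derivatives of functions without a rule of their own. *)
Ltac deriv := eapply deriv_conv; [solve [repeat first
  [ eassumption | apply deriv_cst | apply deriv_id | apply derivD | apply derivN
  | apply derivM | apply deriv_cos | apply deriv_sin | apply deriv_expR | apply deriv_atan]] | lazy beta].

(** * Fourier inversion and Plancherel *)

Section Poisson.
Context (R : realType).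
Implicit Types (f : R -> R) (e y w t a b : R).

(** The Abel summation factor; its cosine transform is the Poisson kernel. *)
Definition pois e w : R := expR (- (e * `|w|)).

Lemma pois_continuous e : continuous (pois e).
Proof.
move=> w; apply: continuous_comp; last exact: continuous_expR.
apply: continuousN; apply: continuousM; first exact: cst_continuous.
exact: norm_continuous.
Qed.

(* The summand 1 makes the integrand nonnegative, as the fundamental theorem on a half-line
   requires. *)
Lemma poisson_half e y : 0 < e ->
  (\int[leb R]_(w in `[0%R, +oo[) (expR (- (e * w)) * (1 + cos (w * y)))%:E =
   (e^-1 + e / (e ^+ 2 + y ^+ 2))%:E)%E.
Proof.
move=> e0; have e20 : 0 < e ^+ 2 + y ^+ 2.
  by rewrite ltr_wpDr ?exprn_gt0// sqr_ge0.
(* [F] is the antiderivative: the quotient comes from the real part of exp((-e + iy)w)/(-e + iy),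
   and [- e^-1] from the summand 1. Since [B] is bounded, [F] tends to 0, and the integral is -
   F(0). *)
pose B w : R := (y * sin (w * y) - e * cos (w * y)) / (e ^+ 2 + y ^+ 2) - e^-1.
pose F w : R := expR (- (e * w)) * B w.
have dF w : is_derive w (1 : R) F (expR (- (e * w)) * (1 + cos (w * y))).
  rewrite /F /B; deriv; field.
  by rewrite !gt_eqF.
have cF := deriv_continuous dF.
have limF : F w @[w --> +oo] --> (0 : R).
  pose M : R := (`|y| + e) / (e ^+ 2 + y ^+ 2) + e^-1.
  have BM w : `|B w| <= M.
    apply: (le_trans (ler_normB _ _)); rewrite [`|e^-1|]gtr0_norm ?invr_gt0//.
    rewrite lerD2r normrM [`|_^-1|]gtr0_norm ?invr_gt0// ler_pM2r ?invr_gt0//.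
    apply: (le_trans (ler_normB _ _)); rewrite !normrM (gtr0_norm e0).
    by apply: lerD; [rewrite ler_piMr// sin_max|rewrite ler_piMr ?cos_max// ltW].
  have lime : M * expR (- (e * w)) @[w --> +oo] --> (0 : R).
    rewrite -[X in _ --> X](mulr0 M); apply: cvgMr.
    have H : e * w @[w --> +oo] --> +oo by apply: gt0_cvgMry => //; exact: cvg_id.
    exact: (@cvg_comp _ _ _ (fun w => e * w) (fun v => expR (- v)) _ _ _ H (@cvgr_expR R)).
  apply/norm_cvg0P; apply: (squeeze_cvgr _ (cvg_cst 0) lime).
  near=> w; rewrite normr_ge0 /= /F normrM (gtr0_norm (expR_gt0 _)) mulrC.
  by rewrite ler_wpM2r ?expR_ge0.
have pos w : 0 <= w -> 0 <= expR (- (e * w)) * (1 + cos (w * y)).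
  by move=> _; rewrite mulr_ge0 ?expR_ge0//; have := cos_geN1 (w * y); lra.
have wc : {within `[0, +oo[, continuous (fun w : R => expR (- (e * w)) * (1 + cos (w * y)))}.
  apply: continuous_subspaceT => w.
  apply: (@deriv_continuous R _ (fun w => - e * expR (- (e * w)) * (1 + cos (w * y))
    - expR (- (e * w)) * (sin (w * y) * y))).
  by move=> t; deriv; ring.
have dv w : 0 < w -> derivable F w 1.
  by move=> _; exact: (@ex_derive _ _ _ _ _ _ _ (dF w)).
have ar : F w @[w --> 0^'+] --> F 0 by apply: cvg_at_right_filter; exact: cF.
have de : {in `]0, +oo[, derive1 F =1 (fun w => expR (- (e * w)) * (1 + cos (w * y)))}.
  by move=> w _; rewrite derive1E; apply: derive_val.
rewrite (ge0_continuous_FTC2y pos wc limF dv ar de) -EFinB; congr (_%:E).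
rewrite /F /B !mul0r mulr0 oppr0 expR0 sin0 cos0; field.
by rewrite !gt_eqF.
Unshelve. all: by end_near. Qed.

Lemma pois_cos1 e y : 0 < e ->
  (\int[leb R]_w (pois e w * (1 + cos (w * y)))%:E =
   (2 / e + 2 * e / (e ^+ 2 + y ^+ 2))%:E)%E.
Proof.
move=> e0; rewrite ge0_symfun_integralT.
- rewrite -set_itvcy (_ : (\int[_]_(x in _) _)%E = (e^-1 + e / (e ^+ 2 + y ^+ 2))%:E).
    by rewrite -EFinM; congr (_%:E); ring.
  rewrite -(poisson_half y e0); apply: eq_integral => w.
  by rewrite inE /= in_itv /= andbT => w0; rewrite /pois ger0_norm.
- by move=> w; rewrite mulr_ge0 ?expR_ge0//; have := cos_geN1 (w * y); lra.
- move=> w; apply: continuousM; first exact: pois_continuous.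
  apply: (@deriv_continuous R _ (fun w => - (sin (w * y) * y))).
  by move=> t; deriv; ring.
- by move=> w /=; rewrite /pois normrN mulNr cosN.
Qed.

Lemma L1_pois e : 0 < e -> L1 (pois e).
Proof.
move=> e0; have mp : measurable_fun [set: R] (pois e).
  by apply: continuous_measurable_fun; exact: pois_continuous.
apply/integrableP; split; first exact/measurable_EFinP.
(* At frequency 0 the integrand is twice [pois e], so the finite value there gives integrability. *)
have := pois_cos1 0 e0.
rewrite (_ : (\int[_]_w _)%E = (\int[leb R]_w (2%:E * `|(pois e w)%:E|))%E); last first.
  apply: eq_integral => w _; rewrite mulr0 cos0 /= ger0_norm ?expR_ge0//.
  by rewrite mulrC EFinM.
rewrite ge0_integralZl//=; last first.
  by apply/measurable_EFinP; apply: measurableT_comp.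
case: (\int[_]_w _)%E => //= [r _|]; first by rewrite ltry.
by rewrite mulry gtr0_sg// mul1e.
Qed.

Lemma pois_cos e y : 0 < e ->
  \int[leb R]_w (pois e w * cos (w * y)) = 2 * e / (e ^+ 2 + y ^+ 2).
Proof.
move=> e0.
have aux (p q r : R) : p + p = q + r -> r = q -> p = q by move=> ? ?; lra.
have Lp := L1_pois e0.
have mc z : measurable_fun [set: R] (fun w : R => cos (w * z)).
  apply: continuous_measurable_fun.
  apply: (@deriv_continuous R _ (fun w => - (sin (w * z) * z))).
  by move=> t; deriv; ring.
have Lc z : L1 (fun w => pois e w * cos (w * z)).
  by apply: (@L1M_bounded _ 1) => // w; exact: cos_max.
have H z : \int[leb R]_w (pois e w) + \int[leb R]_w (pois e w * cos (w * z)) =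
    2 / e + 2 * e / (e ^+ 2 + z ^+ 2).
  rewrite -(RintegralD measurableT Lp (Lc z)).
  transitivity (fine (2 / e + 2 * e / (e ^+ 2 + z ^+ 2))%:E) => //.
  rewrite -(pois_cos1 z e0); congr fine; apply: eq_integral => w _.
  by rewrite mulrDr mulr1.
(* At z = 0 both integrals coincide, which determines the integral of [pois e]; subtracting it from
   the identity at [y] leaves the cosine part. *)
have H0 := H 0; have := H y.
have E0 : \int[leb R]_w (pois e w * cos (w * 0)) = \int[leb R]_w (pois e w).
  by apply: eq_Rintegral => w _; rewrite mulr0 cos0 mulr1.
rewrite E0 in H0.
have -> : \int[leb R]_w (pois e w) = 2 / e.
  by apply: aux H0 _; field; rewrite gt_eqF.
by move/addrI.
Qed.

End Poisson.

(** * Cosine and sine transforms of a real function *)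

Section transforms.
Context (R : realType).
Implicit Types (f : R -> R) (e x y w t a b : R).

(* Real and (negated) imaginary parts of the Fourier transform of a real function, at the
   angular frequency w = 2 pi xi. *)
Definition ct f := ttrans cos f.
Definition st f := ttrans sin f.

Let mcos w : measurable_fun [set: R] (fun x => cos (w * x)).
Proof.
apply: continuous_measurable_fun.
apply: (@deriv_continuous R _ (fun x => - (w * sin (w * x)))).
by move=> t; deriv; ring.
Qed.

Let msin w : measurable_fun [set: R] (fun x => sin (w * x)).
Proof.
apply: continuous_measurable_fun.
apply: (@deriv_continuous R _ (fun x => w * cos (w * x))).
by move=> t; deriv; ring.
Qed.

Lemma L1_cos f w : L1 f -> L1 (fun x => f x * cos (w * x)).
Proof. by move=> Lf; apply: (@L1M_bounded _ 1) => // x; exact: cos_max. Qed.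

Lemma L1_sin f w : L1 f -> L1 (fun x => f x * sin (w * x)).
Proof. by move=> Lf; apply: (@L1M_bounded _ 1) => // x; exact: sin_max. Qed.

Lemma ct_continuous f : L1 f -> continuous (ct f).
Proof.
by move=> Lf; apply: (@ttrans_continuous _ cos (fun t => - sin t)) => // t; exact: cos_max.
Qed.

Lemma st_continuous f : L1 f -> continuous (st f).
Proof.
by move=> Lf; apply: (@ttrans_continuous _ sin cos) => // t; exact: sin_max.
Qed.

Lemma is_derive_ct f w : L1 f -> L1 (fun x => x * f x) ->
  is_derive w (1 : R) (ct f) (- st (fun x => x * f x) w).
Proof.
move=> Lf Lxf; apply: (@deriv_conv _ _ _ (\int[leb R]_x (x * f x * (- sin (w * x))))).
  apply: (@is_derive_ttrans _ cos (fun t => - sin t)) => //.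
  - by move=> t; exact: cos_max.
  - by move=> t; rewrite normrN; exact: sin_max.
rewrite -mulN1r /st /ttrans -RintegralZl//; last exact: L1_sin.
by apply: eq_Rintegral => x _; ring.
Qed.

Lemma is_derive_st f w : L1 f -> L1 (fun x => x * f x) ->
  is_derive w (1 : R) (st f) (ct (fun x => x * f x) w).
Proof.
move=> Lf Lxf; apply: (@is_derive_ttrans _ sin cos) => // t.
- exact: sin_max.
- exact: cos_max.
Qed.

Lemma ct_le f w : L1 f -> `|ct f w| <= \int[leb R]_x `|f x|.
Proof. by move=> Lf; apply: Rintegral_norm_le => // x; exact: cos_max. Qed.

Lemma st_le f w : L1 f -> `|st f w| <= \int[leb R]_x `|f x|.
Proof. by move=> Lf; apply: Rintegral_norm_le => // x; exact: sin_max. Qed.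

Lemma ctN f w : ct f (- w) = ct f w.
Proof. by apply: eq_Rintegral => x _; rewrite mulNr cosN. Qed.

Lemma stN f w : L1 f -> st f (- w) = - st f w.
Proof.
move=> Lf; rewrite -[RHS]mulN1r -RintegralZl//; last exact: L1_sin.
by apply: eq_Rintegral => x _; rewrite mulNr sinN; ring.
Qed.

Lemma ct_st_rotate f w t : L1 f ->
  ct f w * cos (w * t) + st f w * sin (w * t) =
  \int[leb R]_x (f x * cos (w * (x - t))).
Proof.
move=> Lf; rewrite mulrC [in X in _ + X]mulrC.
rewrite -!RintegralZl//; [|exact: L1_sin|exact: L1_cos].
rewrite -RintegralD//; last 2 first.
- by apply: L1Z; exact: L1_cos.
- by apply: L1Z; exact: L1_sin.
by apply: eq_Rintegral => x _; rewrite mulrBr cosB; ring.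
Qed.

(** The real part of the inverse transform in angular frequency, without the factor 1/(2 pi): it
    returns 2 pi f. *)
Definition fourier_inv f t :=
  \int[leb R]_w (ct f w * cos (w * t) + st f w * sin (w * t)).

Lemma fourier_invE f : L1 (ct f) -> L1 (st f) ->
  fourier_inv f = (fun t => ct (ct f) t + st (st f) t).
Proof.
move=> Lc Ls; apply/funext => t; rewrite /fourier_inv /ct /st /ttrans -RintegralD//; last 2 first.
- exact: (L1_cos t Lc).
- exact: (L1_sin t Ls).
by apply: eq_Rintegral => w _; rewrite [w * t]mulrC.
Qed.

Lemma continuous_fourier_inv f : L1 (ct f) -> L1 (st f) -> continuous (fourier_inv f).
Proof.
move=> Lc Ls; rewrite fourier_invE// => t; apply: continuousD; first exact: ct_continuous.
exact: st_continuous.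
Qed.

Lemma mkernel_cos t : measurable_fun [set: R * R] (fun z : R * R => cos (z.2 * (z.1 - t))).
Proof.
apply: measurableT_comp; first by apply: continuous_measurable_fun; exact: continuous_cos.
by apply: measurable_funM => //; apply: measurable_funB.
Qed.

(** Damping the transform by the Abel factor is convolution of f with the Poisson kernel: exchange
    the integrals and use the cosine transform of [pois]. *)
Lemma poisson_smooth f e t : L1 f -> 0 < e ->
  \int[leb R]_w (pois e w * (ct f w * cos (w * t) + st f w * sin (w * t))) =
  \int[leb R]_x (f x * (2 * e / (e ^+ 2 + (x - t) ^+ 2))).
Proof.
move=> Lf e0.
under eq_Rintegral do rewrite ct_st_rotate//.
have := @Fubini_kernel R 1 f (pois e) (fun z => cos (z.2 * (z.1 - t))) Lf (L1_pois e0)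
  (mkernel_cos t) (fun=> cos_max _).
move=> /= ->; apply: eq_Rintegral => x _.
by rewrite pois_cos.
Qed.

End transforms.

(** * Inversion by Abel-Poisson means *)

Section inversion.
Context (R : realType).
Implicit Types (f d : R -> R) (c e x y w t a b : R).

Lemma ae_notin2 a b : {ae leb R, forall x, x != a /\ x != b}.
Proof.
apply: ae_and.
- exists [set a]; split => //; first by rewrite lebesgue_measure_set1.
  by move=> x /= /negP; rewrite negbK => /eqP.
- exists [set b]; split => //; first by rewrite lebesgue_measure_set1.
  by move=> x /= /negP; rewrite negbK => /eqP.
Qed.

Lemma continuous_divl c (D : R -> R) : continuous D -> (forall t, D t != 0) ->
  continuous (fun t => c / D t).
Proof.
move=> cD D0 t; apply: cvgM; first exact: cvg_cst.
by apply: cvgV; [exact: D0|exact: cD].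
Qed.

Lemma Rintegral_poisson_kernel e x a b : 0 < e -> a <= b ->
  \int[leb R]_(t in `[a, b]) (2 * e / (e ^+ 2 + (x - t) ^+ 2)) =
  2 * (atan ((b - x) / e) - atan ((a - x) / e)).
Proof.
move=> e0 ab; have D t : e ^+ 2 + (x - t) ^+ 2 != 0.
  by rewrite gt_eqF// ltr_wpDr ?exprn_gt0// sqr_ge0.
have d t : is_derive t (1 : R) (fun t => 2 * atan ((t - x) / e)) (2 * e / (e ^+ 2 + (x - t) ^+ 2)).
  by deriv; field; rewrite D gt_eqF.
have c : continuous (fun t : R => 2 * e / (e ^+ 2 + (x - t) ^+ 2)).
  apply: continuous_divl => //; apply: (@deriv_continuous R _ (fun t => - (2 * (x - t)))).
  by move=> s; rewrite /GRing.exp /=; deriv; ring.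
by rewrite (Rintegral_FTC ab d c) mulrBr.
Qed.

Lemma atan_scaled_cvg x : x != 0 ->
  atan (x / n.+1%:R^-1) @[n --> \oo] --> (Num.sg x * (pi / 2) : R).
Proof.
have H y : 0 < y -> atan (y / n.+1%:R^-1) @[n --> \oo] --> (pi / 2 : R).
  move=> y0; have H : y * n.+1%:R @[n --> \oo] --> (+oo : set_system R).
    apply/cvgryPge => A; near=> n.
    rewrite -ler_pdivrMl// (@le_trans _ _ n%:R)// ?ler_nat//.
    by near: n; exact: nbhs_infty_ger.
  under eq_fun do rewrite invrK.
  exact: (@cvg_comp _ _ _ (fun n : nat => y * n.+1%:R) atan _ _ _ H (@cvgy_atan R)).
rewrite neq_lt => /orP[x0|x0]; last by rewrite gtr0_sg// mul1r; exact: H.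
rewrite ltr0_sg// mulN1r; have := H (- x); rewrite oppr_gt0 => /(_ x0) K.
under eq_fun do rewrite -[atan _]opprK -atanN -mulNr.
exact: cvgN.
Unshelve. all: by end_near. Qed.

Lemma atan_le2 x : `|atan x| <= (pi / 2 : R).
Proof. by rewrite ler_norml ltW ?atan_gtNpi2// ltW// atan_ltpi2. Qed.

Lemma cvg_fourier_inv f t : L1 f -> L1 (ct f) -> L1 (st f) ->
  \int[leb R]_x (f x * (2 * n.+1%:R^-1 / (n.+1%:R^-1 ^+ 2 + (x - t) ^+ 2))) @[n --> \oo]
  --> fourier_inv f t.
Proof.
move=> Lf Lc Ls; have e0 (n : nat) : 0 < (n.+1%:R^-1 : R) by rewrite invr_gt0 ltr0n.
under eq_fun do rewrite -poisson_smooth//.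
have L : L1 (fun w => ct f w * cos (w * t) + st f w * sin (w * t)).
  apply: L1D.
    by have := L1_cos t Lc; apply: eq_integrable => // w _ /=; rewrite [w * t]mulrC.
  by have := L1_sin t Ls; apply: eq_integrable => // w _ /=; rewrite [w * t]mulrC.
have H := @Rintegral_dominated R 1 _ (fun=> 1) (fun n => pois (n.+1%:R^-1)) L.
under eq_fun do under eq_Rintegral do rewrite mulrC.
have -> : fourier_inv f t = \int[leb R]_w ((ct f w * cos (w * t) + st f w * sin (w * t)) * 1).
  by apply: eq_Rintegral => w _; rewrite mulr1.
apply: H.
- by move=> n; apply: continuous_measurable_fun; exact: pois_continuous.
- exact: measurable_cst.
- move=> n w; rewrite ger0_norm ?expR_ge0// expR_le1 oppr_le0 mulr_ge0//.
- apply: aeW => w; rewrite /pois -[X in _ --> X]expR0.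
  apply: (@cvg_comp _ _ _ (fun n : nat => - (n.+1%:R^-1 * `|w|)) expR); last exact: continuous_expR.
  rewrite -oppr0; apply: cvgN; rewrite -(mul0r `|w|); apply: cvgMl.
  exact: cvg_harmonic.
Qed.

(** Inversion is tested on intervals: integrating the Poisson kernel in t over [a, b] gives a
    difference of arctangents, which converges boundedly to 2 pi times the indicator of [a, b]. The
    integrals of the means thus have two limits, one from each side of [poisson_smooth], and these
    must agree. *)
Lemma fourier_inv_itv f a b : L1 f -> L1 (ct f) -> L1 (st f) -> a <= b ->
  \int[leb R]_(t in `[a, b]) fourier_inv f t = 2 * pi * \int[leb R]_(x in `[a, b]) f x.
Proof.
move=> Lf Lc Ls ab; have e0 (n : nat) : 0 < (n.+1%:R^-1 : R) by rewrite invr_gt0 ltr0n.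
pose K (n : nat) (z : R * R) : R := 2 * n.+1%:R^-1 / (n.+1%:R^-1 ^+ 2 + (z.1 - z.2) ^+ 2).
(* The crude bound 2e/e^2 with e = 1/(n+1); it grows with n but is only used at fixed n, to apply
   Fubini. *)
have Kle n z : `|K n z| <= 2 * n.+1%:R.
  rewrite /K ger0_norm; last first.
    by rewrite divr_ge0 ?mulr_ge0 ?addr_ge0 ?sqr_ge0// ltW.
  have D : 0 < n.+1%:R^-1 ^+ 2 + (z.1 - z.2) ^+ 2.
    by rewrite ltr_wpDr ?exprn_gt0// sqr_ge0.
  rewrite ler_pdivrMr// mulrDr -[leLHS]addr0 lerD//.
    suff -> : 2 * n.+1%:R * n.+1%:R^-1 ^+ 2 = 2 / n.+1%:R :> R by [].
    by field; rewrite addrC natr1 pnatr_eq0.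
  by apply: mulr_ge0; [exact: mulr_ge0|exact: sqr_ge0].
have mK n : measurable_fun [set: R * R] (K n).
  have cK : continuous (fun u : R => 2 * n.+1%:R^-1 / (n.+1%:R^-1 ^+ 2 + u ^+ 2)).
    apply: continuous_divl => u; last by rewrite gt_eqF// ltr_wpDr ?exprn_gt0// sqr_ge0.
    move: u; apply: (@deriv_continuous R _ (fun u => 2 * u)) => u.
    by rewrite /GRing.exp /=; deriv; ring.
  apply: (measurableT_comp (continuous_measurable_fun cK)).
  exact: measurable_funB.
pose g : R -> R := (fun _ : R => 1 : R) \_ `[a, b].
have Lg : L1 g by apply: L1_continuous_itv; exact: cst_continuous.
have gE (h : R -> R) : \int[leb R]_t (g t * h t) = \int[leb R]_(t in `[a, b]) h t.
  rewrite [RHS]Rintegral_mkcond; apply: eq_Rintegral => t _.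
  by rewrite /g /patch; case: ifP; rewrite ?mul1r ?mul0r.
pose P n t := \int[leb R]_x (f x * K n (x, t)).
have PA n : \int[leb R]_t (g t * P n t) =
    \int[leb R]_x (f x * (2 * (atan ((b - x) / n.+1%:R^-1) - atan ((a - x) / n.+1%:R^-1)))).
  rewrite (Fubini_kernel Lf Lg (mK n) (Kle n)); apply: eq_Rintegral => x _.
  by rewrite gE Rintegral_poisson_kernel.
(* On the frequency side the means [P n] are bounded uniformly in n and t, as dominated convergence
   requires. *)
pose M := \int[leb R]_w (`|ct f w| + `|st f w|).
have PE n t : P n t =
    \int[leb R]_w (pois n.+1%:R^-1 w * (ct f w * cos (w * t) + st f w * sin (w * t))).
  by rewrite poisson_smooth.
have L t : L1 (fun w => ct f w * cos (w * t) + st f w * sin (w * t)).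
  apply: L1D.
    by have := L1_cos t Lc; apply: eq_integrable => // w _ /=; rewrite [w * t]mulrC.
  by have := L1_sin t Ls; apply: eq_integrable => // w _ /=; rewrite [w * t]mulrC.
have p1 n w : `|pois n.+1%:R^-1 w| <= (1 : R).
  by rewrite ger0_norm ?expR_ge0// expR_le1 oppr_le0 mulr_ge0// ltW.
have mp n : measurable_fun [set: R] (pois (n.+1%:R^-1 : R)).
  by apply: continuous_measurable_fun; exact: pois_continuous.
have PM n t : `|P n t| <= M.
  rewrite PE.
  under eq_Rintegral do rewrite mulrC.
  apply: (le_trans (Rintegral_norm_le (L t) (mp n) (p1 n))).
  apply: le_Rintegral => //; first exact: (L1_norm (L t)).
    by apply: L1D; exact: L1_norm.
  move=> w _; apply: (le_trans (ler_normD _ _)); rewrite !normrM.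
  by apply: lerD; rewrite ler_piMr// ?cos_max// sin_max.
have mP n : measurable_fun [set: R] (P n).
  apply: continuous_measurable_fun.
  have Lpc : L1 (fun w => pois n.+1%:R^-1 w * ct f w).
    have := L1M_bounded Lc (mp n) (p1 n).
    by apply: eq_integrable => // w _ /=; rewrite mulrC.
  have Lps : L1 (fun w => pois n.+1%:R^-1 w * st f w).
    have := L1M_bounded Ls (mp n) (p1 n).
    by apply: eq_integrable => // w _ /=; rewrite mulrC.
  have -> : P n = (fun t => ct (fun w => pois n.+1%:R^-1 w * ct f w) t
      + st (fun w => pois n.+1%:R^-1 w * st f w) t).
    apply/funext => t; rewrite PE /ct /st /ttrans -RintegralD//; last 2 first.
    - exact: (L1_cos t Lpc).
    - exact: (L1_sin t Lps).
    by apply: eq_Rintegral => w _; rewrite [w * t]mulrC; ring.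
  move=> t; apply: continuousD; first exact: ct_continuous.
  exact: st_continuous.
have mF : measurable_fun [set: R] (fourier_inv f).
  by apply: continuous_measurable_fun; exact: continuous_fourier_inv.
have C1 : \int[leb R]_t (g t * P n t) @[n --> \oo] --> \int[leb R]_t (g t * fourier_inv f t).
  apply: (Rintegral_dominated Lg mP mF PM); apply: aeW => t.
  exact: cvg_fourier_inv.
(* Bounded by 2 pi, and convergent at every x other than the two endpoints. *)
pose A (n : nat) x : R := 2 * (atan ((b - x) / n.+1%:R^-1) - atan ((a - x) / n.+1%:R^-1)).
have mat c (n : nat) : measurable_fun [set: R] (fun x : R => atan ((c - x) / n.+1%:R^-1)).
  apply: continuous_measurable_fun.
  apply: (@deriv_continuous R _ (fun x => (1 + ((c - x) / n.+1%:R^-1) ^+ 2)^-1 * (- n.+1%:R))).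
  by move=> t; deriv; rewrite invrK; congr (_ * _); ring.
have C2 : \int[leb R]_x (f x * A n x) @[n --> \oo] --> \int[leb R]_x (f x * (2 * pi * g x)).
  apply: (@Rintegral_dominated R (2 * pi)) => //.
  - move=> n; apply: measurable_funM; first exact: measurable_cst.
    by apply: measurable_funB; exact: mat.
  - by apply: measurable_funM; [exact: measurable_cst|exact: L1_measurable].
  - move=> n x; rewrite normrM ger0_norm// ler_pM2l//.
    apply: (le_trans (ler_normB _ _)).
    by rewrite [leRHS]splitr lerD// atan_le2.
  - apply: ae_imp (ae_notin2 a b) => x [xa xb].
    have -> : 2 * pi * g x = 2 * (Num.sg (b - x) * (pi / 2) - Num.sg (a - x) * (pi / 2)).
      rewrite /g patchE; case: ifPn; rewrite ?inE ?notin_setE /= in_itv /=.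
        move=> /andP[ax xb']; rewrite gtr0_sg; last by rewrite subr_gt0 lt_neqAle xb.
        by rewrite ltr0_sg; [field|rewrite subr_lt0 lt_neqAle eq_sym xa].
      have -> : (point : R) = 0 by [].
      move=> /negP; rewrite negb_and -!ltNge => /orP[xa'|bx].
        by rewrite !gtr0_sg ?subr_gt0//; [field|exact: lt_le_trans ab].
      by rewrite !ltr0_sg ?subr_lt0//; [field|exact: le_lt_trans bx].
    apply: cvgMr; apply: cvgB; apply: atan_scaled_cvg; rewrite subr_eq0 eq_sym//.
have E : \int[leb R]_t (g t * fourier_inv f t) = \int[leb R]_x (f x * (2 * pi * g x)).
  have C1' : \int[leb R]_x (f x * A n x) @[n --> \oo] --> \int[leb R]_t (g t * fourier_inv f t).
    by move: C1; under eq_fun do rewrite PA.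
  by rewrite -(cvg_lim (@Rhausdorff R) C1') -(cvg_lim (@Rhausdorff R) C2).
rewrite -gE E -gE -RintegralZl//; last first.
  have : L1 (f \_ `[a, b]) by exact: L1_restrict.
  by apply: eq_integrable => // x _ /=; rewrite /g !patchE; case: ifP; rewrite ?mul1r ?mul0r.
by apply: eq_Rintegral => x _; ring.
Qed.

(** By Lebesgue differentiation the primitive of d has derivative d almost everywhere, and here the
    primitive is constant. *)
Lemma L1_ae0 d : L1 d -> (forall x, \int[leb R]_(t in `]-oo, x]) d t = 0) ->
  {ae leb R, forall x, d x = 0}.
Proof.
move=> Ld H; have Ld' y : (leb R).-integrable `]-oo, y] (EFin \o d).
  by apply: integrableS Ld.
have lo : locally_integrable [set: R] d.
  by apply: open_integrable_locally => //; exact: openT.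
have := FTC1Ny Ld' lo; apply: ae_imp => x [_ <-].
rewrite (_ : (fun _ => _) = cst 0); last by apply/funext => y; exact: H.
exact: derive1_cst.
Qed.

(** Only local integrability of g is at hand, so the difference is cut to [-n, n] for each n and the
    countably many null sets are united. *)
Lemma continuous_L1_ae_eq f (g : R -> R) : L1 f -> continuous g ->
  (forall a b, a <= b -> \int[leb R]_(t in `[a, b]) f t = \int[leb R]_(t in `[a, b]) g t) ->
  {ae leb R, forall x, f x = g x}.
Proof.
move=> Lf cg H.
have K (n : nat) : {ae leb R, forall x, ((fun x => f x - g x) \_ `[- n%:R, n%:R]) x = 0}.
  apply: L1_ae0.
    have := L1B (L1_restrict (measurable_itv `[- n%:R, n%:R]) Lf)
      (L1_continuous_itv (- n%:R) n%:R cg).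
    apply: eq_integrable => // x _ /=; rewrite !patchE.
    by case: ifP => _ //; rewrite subr0.
  move=> x; rewrite -Rintegral_mkcondr.
  have [xn|nx] := ltP x (- n%:R).
    rewrite (_ : _ `&` _ = set0) ?Rintegral_set0//.
    rewrite -subset0 => y /= []; rewrite !in_itv /= => yx /andP[ny _].
    by move: (le_lt_trans yx xn); rewrite ltNge ny.
  rewrite (_ : _ `&` _ = `[- n%:R, Num.min x n%:R]%classic); last first.
    apply/seteqP; split => y /=; rewrite !in_itv /= le_min.
      by move=> [-> /andP[-> ->]].
    by move=> /and3P[-> -> ->].
  have nm : - n%:R <= Num.min x n%:R :> R by rewrite le_min nx /=; have := ler0n R n; lra.
  rewrite RintegralB//; last 2 first.
  - exact: integrableS Lf.
  - apply: continuous_compact_integrable; first exact: segment_compact.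
    exact: continuous_subspaceT.
  by rewrite H// subrr.
have := ae_foralln K; apply: ae_imp => x Hx.
have := Hx (Num.truncn `|x|).+1; rewrite patchE ifT; first by move/eqP; rewrite subr_eq0 => /eqP.
rewrite inE /= in_itv /= -ler_norml; apply: ltW; exact: truncnS_gt.
Qed.

Lemma fourier_inversion f : L1 f -> L1 (ct f) -> L1 (st f) ->
  {ae leb R, forall t, fourier_inv f t = 2 * pi * f t}.
Proof.
move=> Lf Lc Ls.
have := @continuous_L1_ae_eq (fun t => 2 * pi * f t) (fourier_inv f) (L1Z _ Lf)
  (continuous_fourier_inv Lc Ls) _.
move=> H; apply: ae_imp (H _) => // a b ab.
rewrite fourier_inv_itv// RintegralZl//; exact: integrableS Lf.
Qed.

(** By Fubini, pairing f with [ct (ct f)] gives the integral of (ct f)^2, and likewise for [st]. The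
    two sum to the pairing of f with [fourier_inv f], which is 2 pi f almost everywhere. The left
    side is an extended integral, so the equality also says that f is square integrable. *)
Lemma Plancherel f : L1 f -> L1 (ct f) -> L1 (st f) ->
  (\int[leb R]_x (f x ^+ 2)%:E =
   ((2 * pi)^-1 * \int[leb R]_w (ct f w ^+ 2 + st f w ^+ 2))%:E)%E.
Proof.
move=> Lf Lc Ls; have mf := L1_measurable Lf.
have mcc : measurable_fun [set: R] (ct f) by exact: L1_measurable.
have mss : measurable_fun [set: R] (st f) by exact: L1_measurable.
have mC : measurable_fun [set: R] (ct (ct f)).
  by apply: continuous_measurable_fun; exact: ct_continuous.
have mS : measurable_fun [set: R] (st (st f)).
  by apply: continuous_measurable_fun; exact: st_continuous.
have LC := L1M_bounded Lf mC (fun t => ct_le t Lc).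
have LS := L1M_bounded Lf mS (fun t => st_le t Ls).
have Lcc : L1 (fun w => ct f w ^+ 2).
  have := L1M_bounded Lc mcc (fun w => ct_le w Lf).
  by apply: eq_integrable => // w _ /=; rewrite expr2.
have Lss : L1 (fun w => st f w ^+ 2).
  have := L1M_bounded Ls mss (fun w => st_le w Lf).
  by apply: eq_integrable => // w _ /=; rewrite expr2.
have mk (k : R -> R) : continuous k -> measurable_fun [set: R * R] (fun z : R * R => k (z.2 * z.1)).
  move=> ck; apply: (measurableT_comp (continuous_measurable_fun ck)).
  by apply: measurable_funM.
have EC : \int[leb R]_x (f x * ct (ct f) x) = \int[leb R]_w (ct f w ^+ 2).
  transitivity (\int[leb R]_y (ct f y * \int[leb R]_x (f x * cos (y * x)))); last first.
    by apply: eq_Rintegral => w _; rewrite expr2.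
  rewrite (Fubini_kernel Lf Lc (mk _ (@continuous_cos R)) (fun=> cos_max _)).
  apply: eq_Rintegral => x _; congr (_ * _).
  by apply: eq_Rintegral => w _ /=; rewrite [x * w]mulrC.
have ES : \int[leb R]_x (f x * st (st f) x) = \int[leb R]_w (st f w ^+ 2).
  transitivity (\int[leb R]_y (st f y * \int[leb R]_x (f x * sin (y * x)))); last first.
    by apply: eq_Rintegral => w _; rewrite expr2.
  rewrite (Fubini_kernel Lf Ls (mk _ (@continuous_sin R)) (fun=> sin_max _)).
  apply: eq_Rintegral => x _; congr (_ * _).
  by apply: eq_Rintegral => w _ /=; rewrite [x * w]mulrC.
have Lfi : L1 (fun x => f x * fourier_inv f x).
  rewrite (fourier_invE Lc Ls); have := L1D LC LS.
  by clear EC ES; apply: eq_integrable => // x _ /=; rewrite mulrDr.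
have E : \int[leb R]_x (f x * fourier_inv f x) =
    \int[leb R]_w (ct f w ^+ 2 + st f w ^+ 2).
  rewrite (RintegralD measurableT Lcc Lss) -EC -ES -(RintegralD measurableT LC LS).
  by apply: eq_Rintegral => x _; rewrite (fourier_invE Lc Ls) mulrDr.
rewrite -E -(RintegralZl _ measurableT Lfi); clear E EC ES mk.
rewrite /Rintegral fineK; last first.
  by apply: integrable_fin_num => //; exact: (L1Z _ Lfi).
apply: ae_eq_integral => //.
- by apply/measurable_EFinP; exact: measurable_funX.
- by apply/measurable_EFinP; exact: (L1_measurable (L1Z _ Lfi)).
apply: ae_imp (fourier_inversion Lf Lc Ls) => x -> _; congr (_%:E).
by rewrite mulrCA mulKf ?expr2// mulf_neq0// gt_eqF// pi_gt0.
Qed.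

End inversion.

(** * Wirtinger inequalities and the quadratic form *)

Section Wirtinger.
Context (R : realType).
Implicit Types (C S dC dS F f : R -> R) (x w a b : R).

Lemma continuous_in_itv f a b : (forall x, a <= x <= b -> {for x, continuous f}) ->
  {within `[a, b], continuous f}.
Proof.
move=> cf; apply: continuous_in_subspaceT => x; rewrite inE /= in_itv /=.
exact: cf.
Qed.

Lemma Rintegral_FTC_itv F f a b : a < b ->
  (forall x, a <= x <= b -> is_derive x (1 : R) F (f x)) ->
  (forall x, a <= x <= b -> {for x, continuous f}) ->
  \int[leb R]_(x in `[a, b]) f x = F b - F a.
Proof.
move=> ab dF cf.
have cF x : a <= x <= b -> {for x, continuous F}.
  move=> /dF dFx; apply/differentiable_continuous/derivable1_diffP.
  exact: (@ex_derive _ _ _ _ _ _ _ dFx).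
rewrite /Rintegral (@continuous_FTC2 _ f F)//.
- exact: continuous_in_itv.
- split.
  + move=> x; rewrite in_itv /= => /andP[ax xb].
    have /dF dFx : a <= x <= b by rewrite !ltW.
    exact: (@ex_derive _ _ _ _ _ _ _ dFx).
  + by apply: cvg_at_right_filter; apply: cF; rewrite lexx ltW.
  + by apply: cvg_at_left_filter; apply: cF; rewrite lexx ltW.
- move=> x; rewrite in_itv /= => /andP[ax xb].
  have /dF dFx : a <= x <= b by rewrite !ltW.
  by rewrite derive1E; apply: derive_val.
Qed.

Lemma integrable_continuous_itv f a b : (forall x, a <= x <= b -> {for x, continuous f}) ->
  (leb R).-integrable `[a, b] (EFin \o f).
Proof.
move=> cf; apply: continuous_compact_integrable; first exact: segment_compact.
exact: continuous_in_itv.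
Qed.

Let pi0 : (0 : R) < pi := pi_gt0 R.

(* Integrate (S' + a tan (a (w - pi/2)) S)^2 >= 0 for a < 1, where the tangent has no pole on
   [0, pi], and let a tend to 1. *)
Lemma Wirtinger_dirichlet S dS :
  (forall w, 0 <= w <= pi -> is_derive w (1 : R) S (dS w)) ->
  (forall w, 0 <= w <= pi -> {for w, continuous dS}) ->
  S 0 = 0 -> S pi = 0 ->
  \int[leb R]_(w in `[0, pi]) (S w ^+ 2) <= \int[leb R]_(w in `[0, pi]) (dS w ^+ 2).
Proof.
move=> dSP cdS S0 Spi.
have cS w : 0 <= w <= pi -> {for w, continuous S}.
  move=> /dSP d; apply/differentiable_continuous/derivable1_diffP.
  exact: (@ex_derive _ _ _ _ _ _ _ d).
have cS2 w : 0 <= w <= pi -> {for w, continuous (fun w => S w ^+ 2)}.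
  by move=> w0; apply: continuousM; exact: cS.
have cdS2 w : 0 <= w <= pi -> {for w, continuous (fun w => dS w ^+ 2)}.
  by move=> w0; apply: continuousM; exact: cdS.
set A := (X in X <= _); set B := (X in _ <= X).
have A0 : 0 <= A by apply: Rintegral_ge0 => w _; exact: sqr_ge0.
have B0 : 0 <= B by apply: Rintegral_ge0 => w _; exact: sqr_ge0.
suff key a : 0 < a < 1 -> a ^+ 2 * A <= B.
  rewrite leNgt; apply/negP => BA; have A1 : 0 < A by exact: le_lt_trans BA.
  (* With a = 1 - d, the quantity a^2 A is at least A - 2dA = (A + B)/2, which exceeds B. *)
  pose d := (A - B) / (4 * A).
  have dA : d * A = (A - B) / 4 by rewrite /d; field; rewrite gt_eqF.
  have d0 : 0 < d by rewrite divr_gt0 ?subr_gt0 ?mulr_gt0.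
  have d1 : d < 1 by rewrite ltr_pdivrMr ?mulr_gt0//; lra.
  have /key : 0 < 1 - d < 1 by apply/andP; split; lra.
  have -> : (1 - d) ^+ 2 * A = A - 2 * (d * A) + d * (d * A) by ring.
  have : 0 <= d * (d * A) by apply: mulr_ge0; [exact: ltW|apply: mulr_ge0; exact: ltW].
  rewrite dA; lra.
move=> /andP[a0 a1].
pose T w : R := tan (a * (w - pi / 2)).
have cos0 w : 0 <= w <= pi -> cos (a * (w - pi / 2)) != 0.
  move=> /andP[w0 wpi]; rewrite gt_eqF// cos_gt0_pihalf// -ltr_norml normrM gtr0_norm//.
  have wl : `|w - pi / 2| <= pi / 2 by rewrite ler_norml; apply/andP; split; lra.
  apply: (@le_lt_trans _ _ (a * (pi / 2))); first by rewrite ler_pM2l.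
  by rewrite -[ltRHS]mul1r ltr_pM2r// divr_gt0.
have dT w : 0 <= w <= pi -> is_derive w (1 : R) T (a * (1 + T w ^+ 2)).
  move=> w0; have cw := cos0 w w0.
  have dl : is_derive w (1 : R) (fun w => a * (w - pi / 2)) a by deriv; ring.
  have H := @is_derive1_comp _ tan (fun w => a * (w - pi / 2)) w _ _ (is_derive_tan cw) dl.
  apply: (deriv_conv H).
  rewrite mulrC; congr (_ * _); rewrite /T /tan.
  have := cos2Dsin2 (a * (w - pi / 2)).
  move: cw; set c := cos _; set s := sin _ => cw E.
  by rewrite expr_div_n -[1 in RHS](@divff _ (c ^+ 2)) ?expf_neq0// -mulrDl E mul1r.
have cT w : 0 <= w <= pi -> {for w, continuous T}.
  move=> /dT d; apply/differentiable_continuous/derivable1_diffP.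
  exact: (@ex_derive _ _ _ _ _ _ _ d).
(* The cross term of the square is hidden in the derivative of [F], whose boundary values vanish
   with S; the tangent satisfies T' = a (1 + T^2), which turns the remaining terms into a perfect
   square. *)
pose F w := a * T w * S w ^+ 2.
pose f w := a ^+ 2 * (1 + T w ^+ 2) * S w ^+ 2 + 2 * a * T w * S w * dS w.
have dF w : 0 <= w <= pi -> is_derive w (1 : R) F (f w).
  move=> w0; have := dT w w0; have := dSP w w0 => H1 H2.
  by rewrite /F /f /GRing.exp /=; deriv; ring.
have cf w : 0 <= w <= pi -> {for w, continuous f}.
  move=> w0; have cTw := cT w w0; have cSw := cS w w0; have cdSw := cdS w w0.
  apply: continuousD; apply: continuousM => //.
  - apply: continuousM; first exact: cst_continuous.
    by apply: continuousD; [exact: cst_continuous|exact: continuousM].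
  - exact: continuousM.
  - apply: continuousM => //; apply: continuousM => //; exact: cst_continuous.
have If := Rintegral_FTC_itv pi0 dF cf.
rewrite {2}/F S0 {1}/F Spi !expr0n /= !mulr0 subr0 in If.
have i1 := integrable_continuous_itv cS2; have i2 := integrable_continuous_itv cdS2.
have i3 := integrable_continuous_itv cf.
have : \int[leb R]_(w in `[0, pi]) (a ^+ 2 * S w ^+ 2 - f w) <= B.
  apply: le_Rintegral => //.
    by apply: (integrableB _ (integrableZl _ (a ^+ 2) i1) i3).
  move=> w _; rewrite -subr_ge0.
  have -> : dS w ^+ 2 - (a ^+ 2 * S w ^+ 2 - f w) = (dS w + a * T w * S w) ^+ 2.
    by rewrite /f; ring.
  exact: sqr_ge0.
rewrite RintegralB//; last by apply: (integrableZl _ (a ^+ 2) i1).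
by rewrite RintegralZl// If subr0.
Qed.

(** The primitive [W] of C vanishes at both ends because C has mean zero, so the Dirichlet case
    bounds the integral of W^2 by that of C^2. Integration by parts gives - W C' the same integral
    as C^2, and (C' + W)^2 >= 0 concludes. *)
Lemma Wirtinger_mean0 C dC :
  (forall w : R, is_derive w (1 : R) C (dC w)) -> continuous dC ->
  C pi = 0 -> \int[leb R]_(w in `[0, pi]) C w = 0 ->
  \int[leb R]_(w in `[0, pi]) (C w ^+ 2) <= \int[leb R]_(w in `[0, pi]) (dC w ^+ 2).
Proof.
move=> dCP cdC Cpi IC.
have cC : continuous C := deriv_continuous dCP.
(* The base point is -1 so that 0 is interior and the derivative there is two-sided. *)
pose W0 w := \int[leb R]_(t in `[-1, w]) C t.
pose W w := W0 w - W0 0.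
have dW0 w : -1 < w -> is_derive w (1 : R) W0 (C w).
  move=> w1; have [] := @continuous_FTC1_closed R C (-1) w (w + 1) _ _ w1 (cC w).
  - lra.
  - by apply: integrable_continuous_itv => x _; exact: cC.
  move=> d1 d2; apply: DeriveDef; first exact: d1.
  by rewrite -derive1E.
have dW w : 0 <= w <= pi -> is_derive w (1 : R) W (C w).
  move=> /andP[w0 _]; have H : is_derive w (1 : R) W0 (C w) by apply: dW0; lra.
  by rewrite /W; deriv; rewrite addr0.
have cW w : 0 <= w <= pi -> {for w, continuous W}.
  move=> /dW d; apply/differentiable_continuous/derivable1_diffP.
  exact: (@ex_derive _ _ _ _ _ _ _ d).
have W00 : W 0 = 0 by rewrite /W subrr.
have Wpi : W pi = 0.
  by have := Rintegral_FTC_itv pi0 dW (fun w _ => cC w); rewrite IC W00 subr0.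
have D := Wirtinger_dirichlet dW (fun w _ => cC w) W00 Wpi.
have iC2 : (leb R).-integrable `[0, pi] (EFin \o (fun w => C w ^+ 2)).
  by apply: integrable_continuous_itv => w _; apply: continuousM; exact: cC.
have idC2 : (leb R).-integrable `[0, pi] (EFin \o (fun w => dC w ^+ 2)).
  by apply: integrable_continuous_itv => w _; apply: continuousM; exact: cdC.
have iW2 : (leb R).-integrable `[0, pi] (EFin \o (fun w => W w ^+ 2)).
  by apply: integrable_continuous_itv => w w0; apply: continuousM; exact: cW.
have cg w : 0 <= w <= pi -> {for w, continuous (fun w => C w ^+ 2 + W w * dC w)}.
  move=> w0; apply: continuousD; first by apply: continuousM; exact: cC.
  by apply: continuousM; [exact: cW|exact: cdC].
have ig := integrable_continuous_itv cg.
have Ig : \int[leb R]_(w in `[0, pi]) (C w ^+ 2 + W w * dC w) = 0.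
  rewrite (Rintegral_FTC_itv (F := fun w => W w * C w) pi0 _ cg).
    by rewrite Cpi W00 mulr0 mul0r subr0.
  move=> w w0; have H1 := dW w w0; have H2 := dCP w.
  by deriv; rewrite expr2.
(* Expand (dC + W)^2 >= 0; the cross term integrates to -2 times the integral of C^2. *)
have : \int[leb R]_(w in `[0, pi]) (2 * C w ^+ 2 - 2 * (C w ^+ 2 + W w * dC w)) <=
       \int[leb R]_(w in `[0, pi]) (dC w ^+ 2 + W w ^+ 2).
  apply: le_Rintegral => //.
  - exact: (integrableB _ (integrableZl _ 2 iC2) (integrableZl _ 2 ig)).
  - exact: (integrableD _ idC2 iW2).
  move=> w _; rewrite -subr_ge0.
  have -> : dC w ^+ 2 + W w ^+ 2 - (2 * C w ^+ 2 - 2 * (C w ^+ 2 + W w * dC w)) =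
    (dC w + W w) ^+ 2 by ring.
  exact: sqr_ge0.
rewrite RintegralB//; last 2 first.
- exact: (integrableZl _ 2 iC2).
- exact: (integrableZl _ 2 ig).
rewrite !RintegralZl// Ig mulr0 subr0 RintegralD//.
lra.
Qed.

End Wirtinger.

(** * Band-limited real functions *)

Section band.
Context (R : realType).
Implicit Types (f g h C S dS F : R -> R) (x w a b : R).

(** Parity of [ct] and [st] covers negative frequencies. The endpoint pi is included: the boundary
    values there are what the orthogonality uses. *)
Definition band f := forall w, pi <= w -> ct f w = 0 /\ st f w = 0.

(** At w = a only right difference quotients are known to vanish; as the derivative exists, it
    equals its right-hand limit. *)
Lemma deriv_vanish a (F dF : R -> R) : (forall w, is_derive w (1 : R) F (dF w)) ->
  (forall w, a <= w -> F w = 0) -> forall w, a <= w -> dF w = 0.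
Proof.
move=> dFP F0 w aw.
have /cvg_ex [/= l Hl] : derivable F w 1 by exact: (@ex_derive _ _ _ _ _ _ _ (dFP w)).
have <- : l = dF w.
  rewrite -(@derive_val _ _ _ _ _ _ _ (dFP w)); apply/esym/cvg_lim => //.
have H := cvg_dnbhs_at_right Hl.
suff H0 : h^-1 *: (F (h%:A + w) - F w) @[h --> 0^'+] --> (0 : R).
  exact: etrans (esym (cvg_lim (@Rhausdorff R) H)) (cvg_lim (@Rhausdorff R) H0).
apply: cvg_near_cst; near=> h; apply/eqP.
have h0 : 0 < h by near: h; exact: nbhs_right_gt.
by rewrite !F0 ?subr0 ?scaler0// /GRing.scale /= mulr1; lra.
Unshelve. all: by end_near. Qed.

(** Multiplication by x differentiates the transform, exchanging [ct] and [st] up to sign. Each use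
    gives one more order of vanishing at pi. *)
Lemma bandX f : L1 f -> L1 (fun x => x * f x) -> band f -> band (fun x => x * f x).
Proof.
move=> Lf Lxf bf w wpi; split.
- apply: (@deriv_vanish pi (st f) (ct (fun x => x * f x))) => //.
    by move=> v; exact: is_derive_st.
  by move=> v /bf[].
- apply/eqP; rewrite -oppr_eq0; apply/eqP.
  apply: (@deriv_vanish pi (ct f) (fun w => - st (fun x => x * f x) w)) => //.
    by move=> v; exact: is_derive_ct.
  by move=> v /bf[].
Qed.

Lemma band_norm f w : L1 f -> band f -> pi <= `|w| -> ct f w = 0 /\ st f w = 0.
Proof.
move=> Lf bf; have [w0|w0] := leP 0 w; first by rewrite ger0_norm//; exact: bf.
rewrite ltr0_norm// => /bf; rewrite ctN (stN _ Lf) => -[-> /eqP].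
by rewrite oppr_eq0 => /eqP.
Qed.

Lemma L1_supp (C : R -> R) : continuous C -> (forall w, pi <= `|w| -> C w = 0) -> L1 C.
Proof.
move=> cC C0; have := L1_continuous_itv (- pi) pi cC.
apply: eq_integrable => // w _ /=; rewrite patchE; case: ifPn => //.
rewrite notin_setE /= in_itv /= -ler_norml => /negP; rewrite -ltNge => /ltW /C0 ->.
by [].
Qed.

Lemma Rintegral_even_supp (C : R -> R) : continuous C -> (forall w, 0 <= C w) ->
  (forall w, C (- w) = C w) -> (forall w, pi <= w -> C w = 0) ->
  \int[leb R]_w C w = 2 * \int[leb R]_(w in `[0, pi]) C w.
Proof.
move=> cC C0 Ce Cs.
have I : (leb R).-integrable `[0, pi] (EFin \o C).
  apply: continuous_compact_integrable; first exact: segment_compact.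
  exact: continuous_subspaceT.
rewrite /Rintegral ge0_symfun_integralT//; last by move=> w /=; rewrite Ce.
rewrite (_ : (\int[_]_(x in [set _ | _]) _)%E = (\int[leb R]_(x in `[0%R, pi]) (C x)%:E)%E).
  by rewrite fineM//; exact: integrable_fin_num.
rewrite integral_mkcond [RHS]integral_mkcond; apply: eq_integral => w _.
rewrite !patchE; case: ifPn; case: ifPn => //; rewrite ?inE ?notin_setE /= in_itv /=.
- move=> /negP; rewrite negb_and -!ltNge => /orP[w0|/ltW /Cs -> //].
  by rewrite leNgt w0.
- by move=> /andP[w0 _] /(_ w0).
Qed.

Lemma band_L1 f : L1 f -> band f -> L1 (ct f) /\ L1 (st f).
Proof.
move=> Lf bf; split; apply: L1_supp.
- exact: ct_continuous.
- by move=> w /(band_norm Lf bf)[].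
- exact: st_continuous.
- by move=> w /(band_norm Lf bf)[].
Qed.

Lemma band_Plancherel f : L1 f -> band f ->
  (\int[leb R]_x (f x ^+ 2)%:E =
   (pi^-1 * \int[leb R]_(w in `[0, pi]) (ct f w ^+ 2 + st f w ^+ 2))%:E)%E.
Proof.
move=> Lf bf; have [Lc Ls] := band_L1 Lf bf.
have cc := ct_continuous Lf; have cs := st_continuous Lf.
have c2 : continuous (fun w : R => ct f w ^+ 2 + st f w ^+ 2).
  move=> w; apply: cvgD; apply: cvgM; [exact: cc|exact: cc|exact: cs|exact: cs].
rewrite Plancherel// (Rintegral_even_supp c2).
- by congr (_%:E); rewrite mulrA; congr (_ * _); rewrite invfM -mulrA mulrCA mulVf ?mulr1.
- by move=> w; rewrite addr_ge0// sqr_ge0.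
- by move=> w; rewrite ctN (stN _ Lf) sqrrN.
- by move=> w /bf[-> ->]; rewrite expr0n addr0.
Qed.

(** Differentiation swaps the parities: the odd part [st h] is compared with the cosine transform of
    x h, the even part [ct h] with its sine transform. The two inequalities add up to the two sides
    of Plancherel. *)
Lemma band_poincare h : L1 h -> L1 (fun x => x * h x) -> band h ->
  \int[leb R]_(w in `[0, pi]) ct h w = 0 ->
  (\int[leb R]_x (h x ^+ 2)%:E <= \int[leb R]_x ((x * h x) ^+ 2)%:E)%E.
Proof.
move=> Lh Lxh bh H0; have bxh := bandX Lh Lxh bh.
have cc := ct_continuous Lh; have cs := st_continuous Lh.
have cxc := ct_continuous Lxh; have cxs := st_continuous Lxh.
have I (C : R -> R) : continuous C -> (leb R).-integrable `[0, pi] (EFin \o (fun w => C w ^+ 2)).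
  move=> cC; apply: integrable_continuous_itv => w _.
  by apply: continuousM; exact: cC.
have [hc hs] := bh pi (lexx _).
have W1 : \int[leb R]_(w in `[0, pi]) (st h w ^+ 2) <=
    \int[leb R]_(w in `[0, pi]) (ct (fun x => x * h x) w ^+ 2).
  apply: (@Wirtinger_dirichlet _ (st h) (ct (fun x => x * h x))).
  + by move=> w _; exact: is_derive_st.
  + by move=> w _; exact: cxc.
  + rewrite /st /ttrans; under eq_Rintegral do rewrite mul0r sin0 mulr0.
    by rewrite Rintegral_cst// mul0r.
  + exact: hs.
have W2 : \int[leb R]_(w in `[0, pi]) (ct h w ^+ 2) <=
    \int[leb R]_(w in `[0, pi]) ((- st (fun x => x * h x) w) ^+ 2).
  apply: (@Wirtinger_mean0 _ (ct h) (fun w => - st (fun x => x * h x) w)).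
  + by move=> w; exact: is_derive_ct.
  + by move=> w; apply: continuousN; exact: cxs.
  + exact: hc.
  + exact: H0.
have W2E : \int[leb R]_(w in `[0, pi]) ((- st (fun x => x * h x) w) ^+ 2) =
    \int[leb R]_(w in `[0, pi]) (st (fun x => x * h x) w ^+ 2).
  by apply: eq_Rintegral => w _; rewrite sqrrN.
rewrite W2E in W2.
have pi1 : 0 < pi^-1 :> R by rewrite invr_gt0 pi_gt0.
rewrite (band_Plancherel Lh bh) (band_Plancherel Lxh bxh) lee_fin (ler_pM2l pi1).
rewrite [X in X <= _]RintegralD; [|by []|exact: I cc|exact: I cs].
rewrite [X in _ <= X]RintegralD; [|by []|exact: I cxc|exact: I cxs].
rewrite [leLHS]addrC; exact: (lerD W1 W2).
Qed.

End band.

(** * The quadratic form and its radical *)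

Section quadratic.
Context (R : realType).
Implicit Types (e f g h q u v : R -> R) (c k r x w a b : R).

(** Certificates for [nra] in the weight comparisons, with t = x^2: the first two products expand to
    t^3 - t^2 - t + 1 and t^3 - 3t + 2. *)
Lemma cubic_ge0 (t : R) : 0 <= t ->
  [/\ 0 <= (t - 1) ^+ 2 * (t + 1), 0 <= (t - 1) ^+ 2 * (t + 2) & 0 <= t * (t * t)].
Proof.
move=> t0; split; [| |by rewrite !mulr_ge0].
- by apply: mulr_ge0; [exact: sqr_ge0|exact: addr_ge0].
- by apply: mulr_ge0; [exact: sqr_ge0|exact: addr_ge0].
Qed.

Lemma eq_L1 f g : f =1 g -> L1 f -> L1 g.
Proof. by move=> fg; rewrite (_ : g = f)//; apply/esym/funext. Qed.

Lemma Rintegral_odd0 f : L1 f -> (forall x, f (- x) = - f x) ->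
  \int[leb R]_x f x = 0.
Proof.
move=> Lf fN.
have mN : measurable_fun [set: R] (-%R : R -> measurableTypeR R).
  by apply: continuous_measurable_fun; exact: oppr_continuous.
have E : (\int[leb R]_x (f x)%:E = \int[leb R]_x (f (- x))%:E)%E.
  transitivity (\int[pushforward (leb R) (-%R : R -> measurableTypeR R)]_x (f x)%:E)%E.
    by apply: eq_measure_integral => A mA _; exact/esym/lebesgue_measureN.
  rewrite integral_pushforward ?preimage_setT//.
  - by apply/measurable_EFinP; exact: L1_measurable.
  - apply: eq_L1 (L1Z (-1) Lf) => x /=.
    by rewrite fN mulN1r.
suff : \int[leb R]_x f x = - \int[leb R]_x f x by lra.
rewrite {1}/Rintegral E -mulN1r -RintegralZl//.
by congr fine; apply: eq_integral => x _; rewrite fN mulN1r.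
Qed.

Lemma L1_cauchy : L1 (fun x : R => (1 + x ^+ 2)^-1).
Proof.
have c : continuous (fun x : R => (1 + x ^+ 2)^-1).
  move=> x; apply: cvgV; first by rewrite gt_eqF// ltr_wpDr// sqr_ge0.
  apply: cvgD; first exact: cvg_cst.
  exact: exprn_continuous.
have p x : 0 <= (1 + x ^+ 2)^-1 by rewrite invr_ge0 addr_ge0// sqr_ge0.
apply/integrableP; split.
  by apply/measurable_EFinP; exact: continuous_measurable_fun.
under eq_integral do rewrite /= ger0_norm//.
rewrite ge0_symfun_integralT//; last by move=> x /=; rewrite sqrrN.
rewrite -set_itvcy (integral0y_oneDsqr R).
by rewrite -EFinM ltry.
Qed.

(** By the arithmetic-geometric mean inequality, 2|q u| <= (1 + x^6) u^2 + q^2/(1 + x^6), and the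
    last term is at most 2/(1 + x^2). The condition on q admits 1, x and x^2, hence two derivatives
    of the transform. *)
Lemma L1_weight u q : measurable_fun [set: R] u -> measurable_fun [set: R] q ->
  L1 (fun x => (1 + x ^+ 6) * u x ^+ 2) ->
  (forall x, q x ^+ 2 * (1 + x ^+ 2) <= 2 * (1 + x ^+ 6)) -> L1 (fun x => q x * u x).
Proof.
move=> mu mq Lu qle.
apply: (L1_le _ (L1D Lu (L1Z 2 L1_cauchy))); first exact: measurable_funM.
move=> x; rewrite normrM.
have A0 : 0 < 1 + x ^+ 6 by rewrite ltr_wpDr// exprn_even_ge0.
have B0 : 0 < 1 + x ^+ 2 by rewrite ltr_wpDr// sqr_ge0.
have := qle x; rewrite -ler_pdivlMr// -[q x ^+ 2]real_normK ?num_real//.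
rewrite -[u x ^+ 2]real_normK ?num_real//.
have := normr_ge0 (q x); have := normr_ge0 (u x).
move: `|q x| `|u x| => Q U U0 Q0.
move: A0 B0; set A := 1 + x ^+ 6; set B := 1 + x ^+ 2 => A0 B0 QAB.
have : Q ^+ 2 / A <= 2 / B.
  by rewrite ler_pdivrMr// mulrAC.
have E : (A * U - Q) ^+ 2 / A = A * U ^+ 2 - 2 * Q * U + Q ^+ 2 / A.
  by field; rewrite gt_eqF.
have : 0 <= (A * U - Q) ^+ 2 / A by rewrite divr_ge0 ?sqr_ge0// ltW.
have : 0 <= Q * U by rewrite mulr_ge0.
rewrite E; nra.
Qed.

(** The domain of the form. The third clause is written [x * (x * u x)] so that [bandX] can be
    iterated. *)
Definition adm u := [/\ L1 u, L1 (fun x => x * u x), L1 (fun x => x * (x * u x)),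
  L1 (fun x => (1 + x ^+ 6) * u x ^+ 2) & band u].

Let mexp n : measurable_fun [set: R] (fun x : R => x ^+ n).
Proof. by apply: continuous_measurable_fun; exact: exprn_continuous. Qed.

Lemma admP u : measurable_fun [set: R] u ->
  L1 (fun x => (1 + x ^+ 6) * u x ^+ 2) ->
  [/\ L1 u, L1 (fun x => x * u x) & L1 (fun x => x * (x * u x))].
Proof.
move=> mu Lu.
have A x : [/\ 0 <= x ^+ 2, x ^+ 4 = x ^+ 2 * x ^+ 2 & x ^+ 6 = x ^+ 2 * (x ^+ 2 * x ^+ 2)].
  by split; [exact: sqr_ge0|ring|ring].
split.
- apply: eq_L1 (@L1_weight u (fun=> 1) mu _ Lu _) => [x|//|x].
    by rewrite mul1r.
  have [x0 _ ->] := A x; move: (x ^+ 2) x0 => t /[dup] t0 /cubic_ge0[]; rewrite expr1n; nra.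
- apply: (@L1_weight u (fun x => x) mu _ Lu _) => // x.
  have [x0 _ ->] := A x; move: (x ^+ 2) x0 => t /[dup] t0 /cubic_ge0[]; nra.
- apply: eq_L1 (@L1_weight u (fun x => x ^+ 2) mu _ Lu _) => [x|//|x].
    by rewrite expr2 mulrA.
  have [x0 _ ->] := A x; move: (x ^+ 2) x0 => t /[dup] t0 /cubic_ge0[]; nra.
Qed.

Lemma L1_weight_mul u v : measurable_fun [set: R] u -> measurable_fun [set: R] v ->
  L1 (fun x => (1 + x ^+ 6) * u x ^+ 2) -> L1 (fun x => (1 + x ^+ 6) * v x ^+ 2) ->
  L1 (fun x => (1 + x ^+ 6) * (u x * v x)).
Proof.
move=> mu mv Lu Lv; apply: (L1_le _ (L1D Lu Lv)).
  apply: measurable_funM; last exact: measurable_funM.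
  by apply: measurable_funD => //; exact: mexp.
move=> x; have A0 : 0 <= 1 + x ^+ 6 by rewrite addr_ge0// exprn_even_ge0.
rewrite normrM (ger0_norm A0) -mulrDr ler_wpM2l// normrM.
rewrite -[u x ^+ 2]real_normK ?num_real// -[v x ^+ 2]real_normK ?num_real//.
have := normr_ge0 (u x); have := normr_ge0 (v x); move: `|u x| `|v x| => U V; nra.
Qed.

Lemma ctD f g a w : L1 f -> L1 g ->
  ct (fun x => f x + a * g x) w = ct f w + a * ct g w.
Proof.
move=> Lf Lg; rewrite /ct /ttrans -(RintegralZl _ measurableT (L1_cos w Lg)).
rewrite -(RintegralD measurableT (L1_cos w Lf) (L1Z a (L1_cos w Lg))).
by apply: eq_Rintegral => x _; ring.
Qed.

Lemma stD f g a w : L1 f -> L1 g ->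
  st (fun x => f x + a * g x) w = st f w + a * st g w.
Proof.
move=> Lf Lg; rewrite /st /ttrans -(RintegralZl _ measurableT (L1_sin w Lg)).
rewrite -(RintegralD measurableT (L1_sin w Lf) (L1Z a (L1_sin w Lg))).
by apply: eq_Rintegral => x _; ring.
Qed.

Lemma admD u v a : adm u -> adm v -> adm (fun x => u x + a * v x).
Proof.
move=> [Lu Lxu _ Wu bu] [Lv Lxv _ Wv bv].
have mu := L1_measurable Lu; have mv := L1_measurable Lv.
have L := L1D Lu (L1Z a Lv).
have W : L1 (fun x => (1 + x ^+ 6) * (u x + a * v x) ^+ 2).
  apply: eq_L1 (L1D (L1D Wu (L1Z (2 * a) (L1_weight_mul mu mv Wu Wv))) (L1Z (a ^+ 2) Wv)) => x.
  by ring.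
have [? ? ?] := admP (L1_measurable L) W; split => // w /[dup] /bu[c1 s1] /bv[c2 s2].
by rewrite (ctD _ _ Lu Lv) (stD _ _ Lu Lv) c1 c2 s1 s2 mulr0 addr0.
Qed.

Lemma L1_form u v n : adm u -> adm v -> (forall x, `|x ^+ n| <= 1 + x ^+ 6) ->
  L1 (fun x => x ^+ n * (u x * v x)).
Proof.
move=> [Lu _ _ Wu _] [Lv _ _ Wv _] H.
have mu := L1_measurable Lu; have mv := L1_measurable Lv.
apply: (L1_le _ (L1_norm (L1_weight_mul mu mv Wu Wv))).
  by apply: measurable_funM; [exact: mexp|exact: measurable_funM].
move=> x; rewrite !normrM ler_wpM2r ?mulr_ge0//.
by apply: (le_trans (H x)); exact: ler_norm.
Qed.

Let le6 x : `|x ^+ 6| <= 1 + x ^+ 6.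
Proof. by rewrite ger0_norm ?exprn_even_ge0// lerDr. Qed.

Let le2 x : `|x ^+ 2| <= 1 + x ^+ 6.
Proof.
rewrite ger0_norm ?sqr_ge0// (_ : x ^+ 6 = x ^+ 2 * (x ^+ 2 * x ^+ 2)); last by ring.
have := sqr_ge0 x; move: (x ^+ 2) => t /[dup] t0 /cubic_ge0[]; nra.
Qed.

Let le0 x : `|x ^+ 0| <= 1 + x ^+ 6.
Proof. by rewrite expr0 normr1 lerDl exprn_even_ge0. Qed.

Lemma L1_form61 u v : adm u -> adm v -> L1 (fun x => (x ^+ 6 - 1) * (u x * v x)).
Proof.
move=> Au Av; apply: eq_L1 (L1B (L1_form Au Av le6) (L1_form Au Av le0)) => x.
by rewrite expr0; ring.
Qed.

Lemma poincare_form h : adm h -> \int[leb R]_(w in `[0, pi]) ct h w = 0 ->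
  0 <= \int[leb R]_x ((x ^+ 2 - 1) * h x ^+ 2).
Proof.
move=> Ah H0; have [Lh Lxh _ _ bh] := Ah.
have L2 : L1 (fun x => (x * h x) ^+ 2).
  by apply: eq_L1 (L1_form Ah Ah le2) => x; ring.
have L0 : L1 (fun x => h x ^+ 2).
  by apply: eq_L1 (L1_form Ah Ah le0) => x; rewrite expr0; ring.
have := band_poincare Lh Lxh bh H0.
rewrite -[leLHS]fineK; last exact: (integrable_fin_num measurableT L0).
rewrite -[leRHS]fineK; last exact: (integrable_fin_num measurableT L2).
rewrite lee_fin -subr_ge0 -/(Rintegral _ _ _) -/(Rintegral _ _ _).
rewrite -(RintegralB measurableT L2 L0) => /le_trans; apply.
by rewrite le_eqVlt; apply/orP; left; apply/eqP; apply: eq_Rintegral => x _; ring.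
Qed.

Lemma form_ge0 h : adm h -> \int[leb R]_(w in `[0, pi]) ct h w = 0 ->
  0 <= \int[leb R]_x ((x ^+ 6 - 1) * (h x * h x)) /\
  (\int[leb R]_x ((x ^+ 6 - 1) * (h x * h x)) = 0 -> {ae leb R, forall x, h x = 0}).
Proof.
move=> Ah H0; have P := poincare_form Ah H0.
have L6 := L1_form61 Ah Ah.
have L2 : L1 (fun x => (x ^+ 2 - 1) * h x ^+ 2).
  apply: eq_L1 (L1B (L1_form Ah Ah le2) (L1_form Ah Ah le0)) => x.
  by rewrite expr0; ring.
pose g x := (x ^+ 6 - 1) * (h x * h x) - 3 * ((x ^+ 2 - 1) * h x ^+ 2).
have Lg : L1 g := L1B L6 (L1Z 3 L2).
(* t^3 - 1 >= 3 (t - 1), tight only at t = 1, with t = x^2. *)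
have gE x : g x = ((x ^+ 2 - 1) ^+ 2 * (x ^+ 2 + 2)) * h x ^+ 2 by rewrite /g; ring.
have g0 x : 0 <= g x.
  rewrite gE; apply: mulr_ge0; last exact: sqr_ge0.
  by apply: mulr_ge0; [exact: sqr_ge0|apply: addr_ge0 => //; exact: sqr_ge0].
have Ig : \int[leb R]_x g x = \int[leb R]_x ((x ^+ 6 - 1) * (h x * h x)) -
    3 * \int[leb R]_x ((x ^+ 2 - 1) * h x ^+ 2).
  by rewrite (RintegralB measurableT L6 (L1Z 3 L2)) (RintegralZl _ measurableT L2).
have Ig0 : 0 <= \int[leb R]_x g x by apply: Rintegral_ge0.
split.
  move: Ig Ig0 P; set A := Rintegral _ _ _; set B := Rintegral _ _ _.
  by set C := Rintegral _ _ _; lra.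
move=> Q0.
have Igz : \int[leb R]_x g x = 0.
  move: Ig Ig0 P Q0; set A := Rintegral _ _ _; set B := Rintegral _ _ _.
  by set C := Rintegral _ _ _; lra.
have /(ae_eq_integral_abs (leb R) measurableT (measurable_int (leb R) Lg)) :
    (\int[leb R]_x `|(EFin \o g) x| = 0)%E.
  under eq_integral do rewrite /= ger0_norm//.
  rewrite -[LHS]fineK; last exact: (integrable_fin_num measurableT Lg).
  by congr (_%:E).
(* The factor multiplying h^2 in [g] vanishes only at 1 and -1, a null set. *)
move=> H; apply: ae_imp (ae_and H (ae_notin2 1 (-1))) => x [/(_ I) [gx]] [x1 xN1].
move/eqP: gx; rewrite gE mulf_eq0 sqrf_eq0 => /orP[|/eqP//].
rewrite mulf_eq0 sqrf_eq0 subr_eq0 sqrf_eq1 (negbTE x1) (negbTE xN1) /=.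
by rewrite gt_eqF// ltr_wpDl// sqr_ge0.
Qed.

(** Substituting the formula for (x^6 - 1) e leaves a combination of the values at pi of the cosine
    transforms of u and x^2 u and of the sine transform of x u. These are boundary values of the
    transform of u and of its first two derivatives, so all three vanish. *)
Lemma form_extremal_ortho u e k r : adm u -> adm e ->
  (forall x, (x ^+ 6 - 1) * e x = (x ^+ 2 - 1) * k * cos (pi * x) - r * x * sin (pi * x)) ->
  \int[leb R]_x ((x ^+ 6 - 1) * (u x * e x)) = 0.
Proof.
move=> [Lu Lxu Lxxu _ bu] Ae eE.
have bxu := bandX Lu Lxu bu; have bxxu := bandX Lxu Lxxu bxu.
have [c0 _] := bu pi (lexx _); have [_ s1] := bxu pi (lexx _).
have [c2 _] := bxxu pi (lexx _).
have C0 := L1Z k (L1_cos pi Lu); have C2 := L1Z k (L1_cos pi Lxxu).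
have S1 := L1Z r (L1_sin pi Lxu).
transitivity (\int[leb R]_x (k * (x * (x * u x) * cos (pi * x)) - k * (u x * cos (pi * x))
    - r * (x * u x * sin (pi * x)))).
  by apply: eq_Rintegral => x _; rewrite mulrCA eE; ring.
rewrite (RintegralB measurableT (L1B C2 C0) S1) (RintegralB measurableT C2 C0).
rewrite (RintegralZl _ measurableT (L1_cos pi Lu)) (RintegralZl _ measurableT (L1_cos pi Lxxu)).
rewrite (RintegralZl _ measurableT (L1_sin pi Lxu)).
move: c0 s1 c2; rewrite /ct /st /ttrans => -> -> ->.
by rewrite !mulr0 !subr0.
Qed.

Lemma form_extremal u e k r : adm u -> adm e ->
  (forall x, (x ^+ 6 - 1) * e x = (x ^+ 2 - 1) * k * cos (pi * x) - r * x * sin (pi * x)) ->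
  \int[leb R]_(w in `[0, pi]) ct e w != 0 ->
  0 <= \int[leb R]_x ((x ^+ 6 - 1) * (u x * u x)) /\
  (\int[leb R]_x ((x ^+ 6 - 1) * (u x * u x)) = 0 ->
   exists c, {ae leb R, forall x, u x = c * e x}).
Proof.
move=> Au Ae eE e0; have [Lu _ _ _ _] := Au; have [Le _ _ _ _] := Ae.
pose c := \int[leb R]_(w in `[0, pi]) ct u w / \int[leb R]_(w in `[0, pi]) ct e w.
pose h x := u x + (- c) * e x.
have Ah : adm h := admD (- c) Au Ae.
have I v : L1 v -> (leb R).-integrable `[0, pi] (EFin \o ct v).
  by move=> Lv; apply: integrable_continuous_itv => w _; exact: ct_continuous.
have h0 : \int[leb R]_(w in `[0, pi]) ct h w = 0.
  transitivity (\int[leb R]_(w in `[0, pi]) (ct u w - c * ct e w)).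
    by apply: eq_Rintegral => w _; rewrite (ctD _ _ Lu Le) mulNr.
  rewrite RintegralB; [|by []|exact: I|]; last first.
    by apply: (integrableZl _ c (I _ Le)).
  rewrite RintegralZl; [|by []|exact: I].
  by rewrite /c divfK// subrr.
have E : \int[leb R]_x ((x ^+ 6 - 1) * (h x * h x)) = \int[leb R]_x ((x ^+ 6 - 1) * (u x * u x)).
  have Luu := L1_form61 Au Au; have Lue := L1_form61 Au Ae; have Lee := L1_form61 Ae Ae.
  transitivity (\int[leb R]_x ((x ^+ 6 - 1) * (u x * u x)
    + (- 2 * c) * ((x ^+ 6 - 1) * (u x * e x)) + c ^+ 2 * ((x ^+ 6 - 1) * (e x * e x)))).
    by apply: eq_Rintegral => x _; rewrite /h; ring.
  rewrite (RintegralD measurableT (L1D Luu (L1Z _ Lue)) (L1Z _ Lee)).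
  rewrite (RintegralD measurableT Luu (L1Z _ Lue)).
  rewrite (RintegralZl _ measurableT Lue) (RintegralZl _ measurableT Lee).
  by rewrite (form_extremal_ortho Au Ae eE) (form_extremal_ortho Ae Ae eE) !mulr0 !addr0.
have [F1 F2] := form_ge0 Ah h0; rewrite E in F1 F2.
split=> // /F2 H; exists c; apply: ae_imp H => x /eqP.
by rewrite /h mulNr subr_eq0 => /eqP.
Qed.

End quadratic.

(** * The extremal function *)

Section continuous_zero.
Context (R : realType).

Lemma continuous_itv0 (f : R -> R) (x d : R) : continuous f -> 0 < d ->
  (forall a b, x - d < a -> a <= b -> b < x + d -> \int[leb R]_(t in `[a, b]) f t = 0) ->
  f x = 0.
Proof.
move=> cf d0 H.
pose a := x - d / 2.
pose F y := \int[leb R]_(t in `[a, y]) f t.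
have ax : a < x by rewrite /a; lra.
have [dF F'] : derivable F x 1 /\ derive1 F x = f x.
  apply: (@continuous_FTC1_closed R f a x (x + 1)) => //; first by rewrite ltrDl.
    by apply: integrable_continuous_itv => y _; exact: cf.
  exact: cf.
rewrite -F' derive1E.
have H0 : h^-1 *: (F (h *: 1 + x) - F x) @[h --> 0^'] --> (0 : R).
  apply: cvg_near_cst; near=> h; apply/eqP.
  have hd : `|h| < d / 2.
    by near: h; apply: dnbhs0_lt; rewrite divr_gt0.
  move: hd; rewrite ltr_norml => /andP[h1 h2].
  by rewrite /F !H ?subr0 ?scaler0//; rewrite /a /GRing.scale /=; lra.
exact: (cvg_lim (@Rhausdorff R) H0).
Unshelve. all: by end_near. Qed.

Lemma continuous_right0 (f : R -> R) (a : R) : continuous f ->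
  (forall x, a < x -> f x = 0) -> f a = 0.
Proof.
move=> cf f0; have H : f x @[x --> a^'+] --> f a.
  by apply: cvg_at_right_filter; exact: cf.
have H0 : f x @[x --> a^'+] --> (0 : R).
  apply: cvg_near_cst; near=> x; apply: f0.
  by near: x; exact: nbhs_right_gt.
exact: etrans (esym (cvg_lim (@Rhausdorff R) H)) (cvg_lim (@Rhausdorff R) H0).
Unshelve. all: by end_near. Qed.

End continuous_zero.

Section extremal.
Context (R : realType).
Implicit Types (x w : R).

Local Notation r3 := (Num.sqrt 3 : R).

Definition ch x : R := (expR x + expR (- x)) / 2.
Definition sh x : R := (expR x - expR (- x)) / 2.

Lemma deriv_ch g x b : is_derive x (1 : R) g b ->
  is_derive x (1 : R) (fun y => ch (g y)) (sh (g x) * b).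
Proof. by move=> H; rewrite /ch /sh; deriv; ring. Qed.

Lemma deriv_sh g x b : is_derive x (1 : R) g b ->
  is_derive x (1 : R) (fun y => sh (g y)) (ch (g x) * b).
Proof. by move=> H; rewrite /ch /sh; deriv; ring. Qed.

Lemma chN x : ch (- x) = ch x. Proof. by rewrite /ch opprK addrC. Qed.
Lemma shN x : sh (- x) = - sh x. Proof. by rewrite /sh opprK -mulNr opprB. Qed.

Lemma sh_gt0 x : 0 < x -> 0 < sh x.
Proof. by move=> x0; rewrite divr_gt0// subr_gt0 ltr_expR; lra. Qed.

Lemma ch_gt0 x : 0 < ch x.
Proof. by rewrite divr_gt0// addr_gt0// expR_gt0. Qed.

Lemma r3_gt0 : 0 < r3. Proof. by rewrite sqrtr_gt0. Qed.
Lemma r3E : r3 * r3 = 3. Proof. by rewrite -expr2 sqr_sqrtr. Qed.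

(** The value of (sqrt 3 / 2) w at the endpoint w = pi, hence the argument of [coth] in the
    extremizer. *)
Definition kap : R := pi * r3 / 2.

Lemma kap_gt0 : 0 < kap.
Proof. by rewrite divr_gt0// mulr_gt0 ?pi_gt0 ?r3_gt0. Qed.

Lemma cothE : coth kap = ch kap / sh kap.
Proof.
have := sh_gt0 kap_gt0; rewrite /coth /ch /sh.
move: (expR kap) (expR (- kap)) => p q pq.
have pq0 : p - q != 0 by apply/eqP => pq1; move: pq; rewrite pq1 mul0r ltxx.
by field.
Qed.

(** The sixth roots of -1 are i, -i and the four numbers (± sqrt 3 ± i)/2. The latter give the real
    solutions [P], [Q] (even) and [U], [V] (odd) of G^(6) = - G, a span closed under
    differentiation. *)
Definition P w : R := ch (r3 / 2 * w) * cos (2^-1 * w).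
Definition Q w : R := sh (r3 / 2 * w) * sin (2^-1 * w).
Definition U w : R := sh (r3 / 2 * w) * cos (2^-1 * w).
Definition V w : R := ch (r3 / 2 * w) * sin (2^-1 * w).

Let dP w : is_derive w (1 : R) P (r3 / 2 * U w - 2^-1 * V w).
Proof.
have c : is_derive w (1 : R) (fun w => cos (2^-1 * w)) (- sin (2^-1 * w) * 2^-1) by deriv; ring.
have h : is_derive w (1 : R) (fun w => ch (r3 / 2 * w)) (sh (r3 / 2 * w) * (r3 / 2)).
  by apply: deriv_ch; deriv; ring.
by rewrite /P /U /V; deriv; ring.
Qed.

Let dQ w : is_derive w (1 : R) Q (r3 / 2 * V w + 2^-1 * U w).
Proof.
have c : is_derive w (1 : R) (fun w => sin (2^-1 * w)) (cos (2^-1 * w) * 2^-1) by deriv; ring.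
have h : is_derive w (1 : R) (fun w => sh (r3 / 2 * w)) (ch (r3 / 2 * w) * (r3 / 2)).
  by apply: deriv_sh; deriv; ring.
by rewrite /Q /U /V; deriv; ring.
Qed.

Let dU w : is_derive w (1 : R) U (r3 / 2 * P w - 2^-1 * Q w).
Proof.
have c : is_derive w (1 : R) (fun w => cos (2^-1 * w)) (- sin (2^-1 * w) * 2^-1) by deriv; ring.
have h : is_derive w (1 : R) (fun w => sh (r3 / 2 * w)) (ch (r3 / 2 * w) * (r3 / 2)).
  by apply: deriv_sh; deriv; ring.
by rewrite /P /Q /U; deriv; ring.
Qed.

Let dV w : is_derive w (1 : R) V (r3 / 2 * Q w + 2^-1 * P w).
Proof.
have c : is_derive w (1 : R) (fun w => sin (2^-1 * w)) (cos (2^-1 * w) * 2^-1) by deriv; ring.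
have h : is_derive w (1 : R) (fun w => ch (r3 / 2 * w)) (sh (r3 / 2 * w) * (r3 / 2)).
  by apply: deriv_ch; deriv; ring.
by rewrite /P /Q /V; deriv; ring.
Qed.

Local Notation s := (sh kap).
Local Notation c := (ch kap).

(* Up to a factor, the Fourier transform of the extremizer: the even solution of G^(6) = - G
   with G, G' and G'' vanishing at pi; [G1], ..., [G5] are its derivatives. *)
Definition G w : R := s * cos w + r3 * P w + Q w.
Definition G1 w : R := - (s * sin w) + 2 * U w.
Definition G2 w : R := - (s * cos w) + r3 * P w - Q w.
Definition G3 w : R := s * sin w + U w - r3 * V w.
Definition G4 w : R := s * cos w - 2 * Q w.
Definition G5 w : R := - (s * sin w) - r3 * V w - U w.

Let dG w : is_derive w (1 : R) G (G1 w).
Proof.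
have HP := dP w; have HQ := dQ w; rewrite /G /G1; deriv.
have r3e := r3E.
by transitivity (- (s * sin w) + (r3 * r3 / 2 + 2^-1) * U w); [field|rewrite r3e; field].
Qed.

Let dG1 w : is_derive w (1 : R) G1 (G2 w).
Proof. by have HU := dU w; rewrite /G1 /G2; deriv; field. Qed.

Let dG2 w : is_derive w (1 : R) G2 (G3 w).
Proof.
have HP := dP w; have HQ := dQ w; rewrite /G2 /G3; deriv.
have r3e := r3E.
by transitivity (s * sin w + (r3 * r3 / 2 - 2^-1) * U w - r3 * V w); [field|rewrite r3e; field].
Qed.

Let dG3 w : is_derive w (1 : R) G3 (G4 w).
Proof.
have HU := dU w; have HV := dV w; rewrite /G3 /G4; deriv.
have r3e := r3E.
by transitivity (s * cos w - (r3 * r3 / 2 + 2^-1) * Q w); [field|rewrite r3e; field].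
Qed.

Let dG4 w : is_derive w (1 : R) G4 (G5 w).
Proof. by have HQ := dQ w; rewrite /G4 /G5; deriv; field. Qed.

Let dG5 w : is_derive w (1 : R) G5 (- G w).
Proof.
have HU := dU w; have HV := dV w; rewrite /G5 /G; deriv.
have r3e := r3E.
by transitivity (- (s * cos w) - r3 * P w + (2^-1 - r3 * r3 / 2) * Q w); [field|rewrite r3e; field].
Qed.

(** As cos(pi/2) = 0, [P] and [U] vanish at pi, and the coefficients of [G] make [G], [G1], [G2]
    vanish there. The surviving values are - sqrt 3 c for [G3] and [G5], and - 3 s for [G4]; they
    produce the numerator of the extremizer. *)
Let atpi : [/\ P pi = 0, Q pi = s, U pi = 0 & V pi = c].
Proof.
have e1 : 2^-1 * pi = pi / 2 :> R by rewrite mulrC.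
have e2 : r3 / 2 * pi = kap by rewrite /kap; field.
by rewrite /P /Q /U /V e1 e2 cos_pihalf sin_pihalf !mulr0 !mulr1.
Qed.

Lemma G_continuous : continuous G. Proof. exact: (deriv_continuous dG). Qed.

Lemma Gpi : G pi = 0.
Proof. by have [Pp Qp _ _] := atpi; rewrite /G Pp Qp cospi; ring. Qed.

Lemma GN w : G (- w) = G w.
Proof. by rewrite /G /P /Q !mulrN chN shN !cosN sinN mulrNN. Qed.

(** [- G5] is a primitive because the sixth derivative of [G] is [- G]. Positivity of the value is
    what later makes the mean of the extremizer's transform nonzero. *)
Lemma Rintegral_G : \int[leb R]_(w in `[0, pi]) G w = r3 * c.
Proof.
have d w : is_derive w (1 : R) (fun w => - G5 w) (G w).
  by have H := dG5 w; deriv; rewrite opprK.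
rewrite (Rintegral_FTC (pi_ge0 R) d G_continuous).
have [_ _ Up Vp] := atpi; rewrite /G5 Up Vp /U /V !mulr0 !sin0 /sh oppr0 sinpi; ring.
Qed.

(** Six integrations by parts reproduce the integral with factor x^6; only the boundary terms in
    [G3], [G4], [G5] survive. Keeping x^6 - 1 on the left makes the identity valid at x = 1 and x =
    -1 too. *)
Lemma Rintegral_G_cos x : (x ^+ 6 - 1) * \int[leb R]_(w in `[- pi, pi]) (G w * cos (x * w)) =
  2 * r3 * s * ((x ^+ 2 - 1) * (c / s) * cos (pi * x) - r3 * x * sin (pi * x)).
Proof.
(* All six boundary terms at once: in the derivative everything telescopes except the two extreme
   terms. [T] is odd, so the boundary contributes 2 T(pi). *)
pose T w := G5 w * cos (x * w) + x * (G4 w * sin (x * w)) - x ^+ 2 * (G3 w * cos (x * w))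
  - x ^+ 3 * (G2 w * sin (x * w)) + x ^+ 4 * (G1 w * cos (x * w)) + x ^+ 5 * (G w * sin (x * w)).
have cc w : is_derive w (1 : R) (fun w => cos (x * w)) (- (x * sin (x * w))) by deriv; ring.
have ss w : is_derive w (1 : R) (fun w => sin (x * w)) (x * cos (x * w)) by deriv; ring.
have dT w : is_derive w (1 : R) T ((x ^+ 6 - 1) * (G w * cos (x * w))).
  have Hc := cc w; have Hs := ss w.
  have H0 := dG w; have H1 := dG1 w; have H2 := dG2 w.
  have H3 := dG3 w; have H4 := dG4 w; have H5 := dG5 w.
  by rewrite /T; deriv; ring.
have cGc : continuous (fun w => G w * cos (x * w)).
  by move=> w; apply: cvgM; [exact: G_continuous|exact: (deriv_continuous cc)].
have cT : continuous (fun w => (x ^+ 6 - 1) * (G w * cos (x * w))).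
  by move=> w; apply: cvgM; [exact: cvg_cst|exact: cGc].
have le : - pi <= pi :> R by have := pi_ge0 R; lra.
rewrite -RintegralZl//; last by apply: integrable_continuous_itv => w _; exact: cGc.
rewrite (Rintegral_FTC le dT cT).
have TN w : T (- w) = - T w.
  have N1 : G1 (- w) = - G1 w by rewrite /G1 /U !mulrN shN cosN sinN; ring.
  have N2 : G2 (- w) = G2 w by rewrite /G2 /P /Q !mulrN chN shN !cosN sinN; ring.
  have N3 : G3 (- w) = - G3 w by rewrite /G3 /U /V !mulrN chN shN !cosN !sinN; ring.
  have N4 : G4 (- w) = G4 w by rewrite /G4 /Q !mulrN shN !cosN sinN; ring.
  have N5 : G5 (- w) = - G5 w by rewrite /G5 /U /V !mulrN chN shN !cosN !sinN; ring.
  by rewrite /T GN N1 N2 N3 N4 N5 mulrN cosN sinN; ring.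
have s0 : s != 0 by rewrite gt_eqF// sh_gt0// kap_gt0.
have r3e := r3E.
rewrite TN opprK /T Gpi; have [Pp Qp Up Vp] := atpi.
rewrite /G1 /G2 /G3 /G4 /G5 Pp Qp Up Vp cospi sinpi [x * pi]mulrC.
transitivity (2 * r3 * c * (x ^+ 2 - 1) * cos (pi * x) - 2 * (r3 * r3) * s * x * sin (pi * x)).
  by rewrite r3e; ring.
by field.
Qed.

End extremal.

(** * The extremizer as the cosine transform of the truncated [G] *)

Section extremal_function.
Context (R : realType).
Implicit Types (x w : R).

Local Notation r3 := (Num.sqrt 3 : R).
Local Notation s := (sh (kap R)).
Local Notation c := (ch (kap R)).

(** The real function underlying [extremal_fun], with the same body so that the two agree by
    conversion. *)
Definition ext x : R :=
  if x ^+ 6 == 1 then lim (extremal_quotient y @[y --> x^']) else extremal_quotient x.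

Let F : R -> R := @G R \_ `[- pi, pi].

Let s0 : 0 < s. Proof. exact: sh_gt0 (kap_gt0 R). Qed.

Let LF : L1 F. Proof. by apply: L1_continuous_itv; exact: G_continuous. Qed.

Let ctFE x : ct F x = \int[leb R]_(w in `[- pi, pi]) (G w * cos (x * w)).
Proof.
rewrite [RHS]Rintegral_mkcond; apply: eq_Rintegral => w _.
by rewrite /F !patchE; case: ifP => // _; rewrite -[RHS](mul0r (cos (x * w))).
Qed.

Let FN w : F (- w) = F w.
Proof.
rewrite /F !patchE GN; congr (if _ then _ else _).
by apply/idP/idP; rewrite !inE /= !in_itv /= => /andP[h1 h2]; apply/andP; split; lra.
Qed.

Let stF0 : st F = fun=> 0.
Proof.
apply/funext => x; apply: Rintegral_odd0; first exact: L1_sin.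
by move=> w; rewrite FN mulrN sinN mulrN.
Qed.

Let K : R := 2 * r3 * s.
Let K0 : 0 < K.
Proof. by apply: mulr_gt0 => //; apply: mulr_gt0 => //; exact: r3_gt0. Qed.

Let quotientE x : x ^+ 6 != 1 -> extremal_quotient x = K^-1 * ct F x.
Proof.
move=> x6; have x61 : x ^+ 6 - 1 != 0 by rewrite subr_eq0.
have E := Rintegral_G_cos x; rewrite -ctFE in E.
apply: (mulfI x61); rewrite [RHS]mulrCA E mulKf ?gt_eqF//.
by rewrite /extremal_quotient -/(kap R) cothE mulrC divfK.
Qed.

Let sixth_root x : x ^+ 6 = 1 -> x = 1 \/ x = -1.
Proof.
move=> x6; have : (x ^+ 2 - 1) * ((x ^+ 2) ^+ 2 + x ^+ 2 + 1) = 0.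
  by transitivity (x ^+ 6 - 1); [ring|rewrite x6 subrr].
move/eqP; rewrite mulf_eq0 => /orP[|/eqP H].
  rewrite subr_eq0 sqrf_eq1 => /orP[/eqP ->|/eqP ->]; by [left|right].
have := sqr_ge0 x; have := sqr_ge0 (x ^+ 2); lra.
Qed.

(** Away from 1 and -1 this is the computed quotient. At these points the quotient coincides nearby
    with a continuous function, so the limit is its value: the singularities are removable. *)
Lemma extE x : ext x = K^-1 * ct F x.
Proof.
rewrite /ext; case: eqVneq => [x6|]; last exact: quotientE.
apply: (cvg_lim (@Rhausdorff R)).
have H : K^-1 * ct F y @[y --> x^'] --> K^-1 * ct F x.
  apply: cvgM; first exact: cvg_cst.
  by apply: cvg_within_filter; exact: ct_continuous.
apply: cvg_trans H; apply: near_eq_cvg; near=> y.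
rewrite quotientE//; apply/eqP => y6.
have yx : y != x by near: y; exact: nbhs_dnbhs_neq.
(* The roots 1 and -1 are at distance 2, so the other one is out of reach. *)
have d1 : `|y - x| < 1.
  near: y; apply: cvg_within; have := @nbhsx_ballx _ _ x 1 ltr01.
  by apply: filterS => y; rewrite /ball /= distrC.
move: yx d1; case: (sixth_root x6) => ->; case: (sixth_root y6) => ->; rewrite ?eqxx//.
  by move=> _; rewrite ltr_norml; lra.
by move=> _; rewrite ltr_norml; lra.
Unshelve. all: by end_near. Qed.

Lemma ext_continuous : continuous ext.
Proof.
have -> : ext = (fun x => K^-1 * ct F x) by apply/funext => x; exact: extE.
by move=> x; apply: cvgM; [exact: cvg_cst|exact: ct_continuous].
Qed.

Lemma ext_measurable : measurable_fun [set: R] ext.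
Proof. by apply: continuous_measurable_fun; exact: ext_continuous. Qed.

Lemma ext_form x : (x ^+ 6 - 1) * ext x =
  (x ^+ 2 - 1) * coth (kap R) * cos (pi * x) - r3 * x * sin (pi * x).
Proof.
have E := Rintegral_G_cos x; rewrite -ctFE in E.
by rewrite extE mulrCA E mulKf ?gt_eqF// cothE.
Qed.

Lemma ext_decay : exists M, forall x, (1 + x ^+ 4) * `|ext x| <= M.
Proof.
pose B : R := K^-1 * \int[leb R]_w `|F w|.
have eB x : `|ext x| <= B.
  rewrite extE normrM gtr0_norm ?invr_gt0// /B ler_pM2l ?invr_gt0//.
  exact: ct_le.
pose A : R := `|coth (kap R)| + r3.
have nA x : `|(x ^+ 6 - 1) * ext x| <= A * (1 + x ^+ 2).
  rewrite ext_form; apply: (le_trans (ler_normB _ _)); rewrite [leRHS]mulrDl; apply: lerD.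
    apply: (@le_trans _ _ `|(x ^+ 2 - 1) * coth (kap R)|).
      by rewrite [leLHS]normrM ler_piMr// cos_max.
    rewrite normrM mulrC ler_wpM2l//.
    by apply: (le_trans (ler_normB _ _)); rewrite normr1 ger0_norm ?sqr_ge0// addrC.
  rewrite -mulrA normrM (gtr0_norm (r3_gt0 R)) ler_pM2l ?r3_gt0// normrM.
  apply: (@le_trans _ _ `|x|); first by rewrite ler_piMr// sin_max.
  rewrite -[x ^+ 2]real_normK ?num_real//.
  have := sqr_ge0 (`|x| - 1); rewrite sqrrB expr1n; have := sqr_ge0 `|x|; lra.
have A0 : 0 <= A by rewrite addr_ge0// ltW// r3_gt0.
have B0 : 0 <= B by apply: le_trans (eB 0).
(* With t = x^2: for t <= 4 one has 1 + t^2 <= 17 and the uniform bound [B] applies; for t > 4 the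
   inequality (1 + t)(1 + t^2) <= 4 (t^3 - 1) gives [4 * A]. *)
exists (17 * B + 4 * A) => x.
have x4 : x ^+ 4 = x ^+ 2 * x ^+ 2 by ring.
have x6 : x ^+ 6 = x ^+ 2 * (x ^+ 2 * x ^+ 2) by ring.
have t0 := sqr_ge0 x; have := eB x; have := nA x; rewrite normrM x4 x6.
have := normr_ge0 (ext x); move: (x ^+ 2) t0 (`|ext x| : R) => t t0 E E0.
have [t4|t4] := leP t 4.
  move=> _ EB; have : (1 + t * t) * E <= 17 * B.
    apply: ler_pM => //; first by rewrite addr_ge0// mulr_ge0.
    nra.
  lra.
have p0 : 0 < t * (t * t) - 1 by nra.
rewrite gtr0_norm// => H _.
suff : (1 + t * t) * E <= 4 * A by lra.
rewrite -(ler_pM2l p0).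
have tt : (1 + t) * (1 + t * t) <= 4 * (t * (t * t) - 1) by nra.
apply: (@le_trans _ _ (A * (1 + t) * (1 + t * t))).
  by rewrite mulrCA mulrC ler_wpM2r// addr_ge0// mulr_ge0.
have -> : (t * (t * t) - 1) * (4 * A) = A * (4 * (t * (t * t) - 1)) by ring.
by rewrite -mulrA ler_wpM2l.
Qed.

(** Decay of order x^-4 makes the weighted square O(1/(1 + x^2)). *)
Lemma ext_weight : L1 (fun x => (1 + x ^+ 6) * ext x ^+ 2).
Proof.
have [M HM] := ext_decay.
apply: (L1_le _ (L1Z (2 * M ^+ 2) (@L1_cauchy R))).
  apply: continuous_measurable_fun => x; apply: cvgM.
    by apply: cvgD; [exact: cvg_cst|exact: exprn_continuous].
  by apply: cvgM; exact: ext_continuous.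
move=> x; rewrite ger0_norm; last first.
  by apply: mulr_ge0; [rewrite addr_ge0// exprn_even_ge0|exact: sqr_ge0].
rewrite ler_pdivlMr ?ltr_wpDr ?sqr_ge0//.
have x4 : x ^+ 4 = x ^+ 2 * x ^+ 2 by ring.
have x6 : x ^+ 6 = x ^+ 2 * (x ^+ 2 * x ^+ 2) by ring.
have := HM x; rewrite -[ext x ^+ 2]real_normK ?num_real// x4 x6.
have := normr_ge0 (ext x); move: (sqr_ge0 x).
move: (x ^+ 2) (`|ext x| : R) => t E t0 E0 EM.
have EM0 : 0 <= (1 + t * t) * E by rewrite mulr_ge0// addr_ge0// mulr_ge0.
have EM2 : ((1 + t * t) * E) ^+ 2 <= M ^+ 2 by rewrite ler_pXn2r ?nnegrE// (le_trans EM0).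
apply: (@le_trans _ _ (2 * ((1 + t * t) * E) ^+ 2)); last by rewrite ler_pM2l.
have -> : (1 + t * (t * t)) * E ^+ 2 * (1 + t) = (1 + t * (t * t)) * (1 + t) * E ^+ 2 by ring.
have -> : 2 * ((1 + t * t) * E) ^+ 2 = 2 * (1 + t * t) ^+ 2 * E ^+ 2 by ring.
rewrite ler_wpM2r ?sqr_ge0//.
have := sqr_ge0 (t * t - t); have := sqr_ge0 (t - 1); nra.
Qed.

Let Le : L1 ext.
Proof. by have [] := admP ext_measurable ext_weight. Qed.

Let ctF_ext : ct F = (fun x => K * ext x).
Proof. by apply/funext => x; rewrite extE mulVKf// gt_eqF. Qed.

Let LctF : L1 (ct F). Proof. by rewrite ctF_ext; exact: L1Z. Qed.
Let LstF : L1 (st F).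
Proof. by rewrite stF0; apply: eq_L1 (L1Z 0 Le) => x; rewrite mul0r. Qed.

Let invF w : fourier_inv F w = K * ct ext w.
Proof.
rewrite fourier_invE// stF0 ctF_ext.
rewrite (_ : st (fun=> 0) w = 0); last first.
  rewrite /st /ttrans; under eq_Rintegral do rewrite mul0r.
  by rewrite Rintegral_cst// mul0r.
rewrite addr0 /ct /ttrans -(RintegralZl _ measurableT (L1_cos w Le)).
by apply: eq_Rintegral => x _; rewrite mulrA.
Qed.

Let invF_continuous : continuous (fourier_inv F).
Proof. exact: continuous_fourier_inv. Qed.

(** Since [ct F] is a multiple of [ext], the inversion integral of [F] is a multiple of [ct ext].
    Inversion on small intervals inside the band compares it with 2 pi [G], and continuity on both
    sides makes the comparison pointwise. *)
Lemma ct_ext_in w : `|w| < pi -> ct ext w = K^-1 * (2 * pi) * G w.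
Proof.
move=> wpi; have [w1 w2] : - pi < w /\ w < pi by apply/andP; rewrite -ltr_norml.
have d0 : 0 < pi - `|w| by rewrite subr_gt0.
have cf : continuous (fun w => fourier_inv F w - 2 * pi * G w).
  move=> v; apply: cvgB; first exact: invF_continuous.
  by apply: cvgM; [exact: cvg_cst|exact: G_continuous].
have H : fourier_inv F w - 2 * pi * G w = 0.
  apply: (continuous_itv0 cf d0) => a b wa ab bw.
  have iG u v : (leb R).-integrable `[u, v] (EFin \o @G R).
    by apply: integrable_continuous_itv => t _; exact: G_continuous.
  rewrite RintegralB; [|by []| |]; last 2 first.
  - by apply: integrable_continuous_itv => t _; exact: invF_continuous.
  - exact: (integrableZl _ (2 * pi) (iG a b)).
  rewrite fourier_inv_itv// RintegralZl// -mulrBr.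
  rewrite (_ : Rintegral _ _ _ = \int[leb R]_(t in `[a, b]) G t) ?subrr ?mulr0//.
  apply: eq_Rintegral => t; rewrite inE /= in_itv /= => /andP[at_ tb].
  rewrite /F patchE ifT// inE /= in_itv /=.
  have := ler_norm w; have := ler_norm (- w); rewrite normrN => h1 h2.
  by apply/andP; split; lra.
move/eqP: H; rewrite invF subr_eq0 => /eqP H.
by rewrite -mulrA -H mulKf// gt_eqF.
Qed.

(** The same comparison beyond pi, where [F] is zero; continuity settles pi itself, and the sine
    transform vanishes because [ext] is even. *)
Lemma ext_band : band ext.
Proof.
have out w : pi < w -> ct ext w = 0.
  move=> piw; have d0 : 0 < w - pi by rewrite subr_gt0.
  have H : fourier_inv F w = 0.
    apply: (continuous_itv0 invF_continuous d0) => a b wa ab bw.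
    rewrite fourier_inv_itv// (_ : Rintegral _ _ _ = 0) ?mulr0//.
    transitivity (\int[leb R]_(t in `[a, b]) (0 : R)); last by rewrite Rintegral_cst// mul0r.
    apply: eq_Rintegral => t; rewrite inE /= in_itv /= => /andP[at_ tb].
    rewrite /F patchE ifF//; apply/negbTE; rewrite notin_setE /= in_itv /= => /andP[_]; lra.
  by move/eqP: H; rewrite invF mulf_eq0 gt_eqF//= => /eqP.
move=> w; rewrite le_eqVlt => /predU1P[<-|piw]; split.
- by apply: continuous_right0 => //; exact: ct_continuous.
- apply: Rintegral_odd0; first exact: L1_sin.
  by move=> x; rewrite !extE ctN mulrN sinN mulrN.
- exact: out.
- apply: Rintegral_odd0; first exact: L1_sin.
  by move=> x; rewrite !extE ctN mulrN sinN mulrN.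
Qed.

Lemma ext_adm : adm ext.
Proof.
have [? ? ?] := admP ext_measurable ext_weight.
by split => //; [exact: ext_weight|exact: ext_band].
Qed.

Lemma ext_mean_neq0 : \int[leb R]_(w in `[0, pi]) ct ext w != 0.
Proof.
rewrite (_ : Rintegral _ _ _ = \int[leb R]_(w in `[0, pi]) (K^-1 * (2 * pi) * G w)).
  rewrite RintegralZl//; last first.
    by apply: integrable_continuous_itv => t _; exact: G_continuous.
  rewrite Rintegral_G gt_eqF//; apply: mulr_gt0.
    apply: mulr_gt0; first by rewrite invr_gt0.
    by apply: mulr_gt0 => //; exact: pi_gt0.
  by rewrite mulr_gt0 ?r3_gt0 ?ch_gt0.
apply: eq_Rintegral => w; rewrite inE /= in_itv /= => /andP[w0].
rewrite le_eqVlt => /predU1P[->|wpi].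
  by rewrite Gpi mulr0; have [] := ext_band (lexx pi).
by apply: ct_ext_in; rewrite ger0_norm.
Qed.

End extremal_function.

(** * Band limitation of complex-valued functions *)

Section band_of_limit.
Context (R : realType).
Implicit Types (p q d f : R -> R) (a b x w M C eta : R).

(* The real part of the Fourier transform of p + i q at the frequency w, since
   Re (e^(-i t) (p + i q)) = p cos t + q sin t; the imaginary part is [rot q (- p)]. *)
Definition rot p q w : R := ct p (2 * pi * w) + st q (2 * pi * w).

Let cont2pi (F : R -> R) : continuous F -> continuous (fun w => F (2 * pi * w)).
Proof.
move=> cF w; apply: (@cvg_comp _ _ _ (fun w => 2 * pi * w) F); last exact: cF.
by apply: cvgM; [exact: cvg_cst|exact: cvg_id].
Qed.

Lemma rot_continuous p q : L1 p -> L1 q -> continuous (rot p q).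
Proof.
move=> Lp Lq w; apply: cvgD.
- exact: (cont2pi (ct_continuous Lp)).
- exact: (cont2pi (st_continuous Lq)).
Qed.

Let ind a b : R -> R := (fun _ : R => 1 : R) \_ `[a, b].

Let L1_ind a b : L1 (ind a b).
Proof. by apply: L1_continuous_itv; exact: cst_continuous. Qed.

Let indE a b (h : R -> R) : \int[leb R]_t (ind a b t * h t) = \int[leb R]_(t in `[a, b]) h t.
Proof.
rewrite [RHS]Rintegral_mkcond; apply: eq_Rintegral => t _.
by rewrite /ind !patchE; case: ifP => _; rewrite ?mul1r// -[RHS](mul0r (h t)).
Qed.

(** The transform of an indicator is at most its L^1 norm [N], and at most 1/|x| by explicit
    integration; adding the squared bounds gives N^2 + 1. *)
Let kernel_decay a b : a <= b -> exists2 C, 0 <= C &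
  forall x, ct (ind a b) (2 * pi * x) ^+ 2 <= C / (1 + x ^+ 2) /\
            st (ind a b) (2 * pi * x) ^+ 2 <= C / (1 + x ^+ 2).
Proof.
move=> ab; have pi0 := pi_gt0 R.
pose N : R := \int[leb R]_t `|ind a b t|.
exists (N ^+ 2 + 1); first by rewrite addr_ge0// sqr_ge0.
have key (y x : R) : `|y| <= N -> `|2 * pi * x * y| <= 2 -> y ^+ 2 <= (N ^+ 2 + 1) / (1 + x ^+ 2).
  move=> yN xy; rewrite ler_pdivlMr ?ltr_wpDr ?sqr_ge0// mulrDr mulr1 lerD//.
    by rewrite -[y ^+ 2]real_normK ?num_real// ler_pXn2r ?nnegrE// (le_trans _ yN).
  have xy1 : `|x * y| <= 1.
    have pi1 : 1 <= pi :> R by have := pi_ge2 R; lra.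
    rewrite -(ler_pM2l (ltr0Sn R 1)) mulr1; apply: le_trans xy.
    have -> : 2 * pi * x * y = 2 * pi * (x * y) by ring.
    by rewrite [leRHS]normrM ler_wpM2r// gtr0_norm ?mulr_gt0//; lra.
  by rewrite -exprMn mulrC -[_ ^+ 2]real_normK ?num_real// expr_le1.
move=> x; split; apply: key; [exact: ct_le| |exact: st_le|].
- rewrite /ct /ttrans indE.
  have d t : is_derive t (1 : R) (fun t => sin (2 * pi * x * t))
      (2 * pi * x * cos (2 * pi * x * t)).
    by deriv; ring.
  have ccos : continuous (fun t : R => cos (2 * pi * x * t)).
    apply: (@deriv_continuous R _ (fun t => - (2 * pi * x * sin (2 * pi * x * t)))) => t.
    by deriv; ring.
  rewrite -RintegralZl//; last by apply: integrable_continuous_itv => t _; exact: ccos.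
  rewrite (Rintegral_FTC ab d); last by move=> t; apply: cvgM; [exact: cvg_cst|exact: ccos].
  apply: (le_trans (ler_normB _ _)).
  have := sin_max (2 * pi * x * b); have := sin_max (2 * pi * x * a); lra.
- rewrite /st /ttrans indE.
  have d t : is_derive t (1 : R) (fun t => - cos (2 * pi * x * t))
      (2 * pi * x * sin (2 * pi * x * t)).
    by deriv; ring.
  have csin : continuous (fun t : R => sin (2 * pi * x * t)).
    apply: (@deriv_continuous R _ (fun t => 2 * pi * x * cos (2 * pi * x * t))) => t.
    by deriv; ring.
  rewrite -RintegralZl//; last by apply: integrable_continuous_itv => t _; exact: csin.
  rewrite (Rintegral_FTC ab d); last by move=> t; apply: cvgM; [exact: cvg_cst|exact: csin].
  apply: (le_trans (ler_normB _ _)); rewrite !normrN.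
  have := cos_max (2 * pi * x * b); have := cos_max (2 * pi * x * a); lra.
Qed.

(** Used in the role of Cauchy-Schwarz: when the integral of y^2 is at most eta^2, both terms
    integrate to a multiple of eta. *)
Let young (eta y z : R) : 0 < eta -> `|y * z| <= y ^+ 2 / (2 * eta) + eta / 2 * z ^+ 2.
Proof.
move=> e0; rewrite normrM -[y ^+ 2]real_normK ?num_real// -[z ^+ 2]real_normK ?num_real//.
move: (`|y| : R) (`|z| : R) => Y Z.
have E : (Y - eta * Z) ^+ 2 / (2 * eta) = Y ^+ 2 / (2 * eta) + eta / 2 * Z ^+ 2 - Y * Z.
  by field; rewrite gt_eqF.
have : 0 <= (Y - eta * Z) ^+ 2 / (2 * eta) by rewrite divr_ge0 ?sqr_ge0// mulr_ge0// ltW.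
by rewrite E subr_ge0.
Qed.

Lemma L1_sqr p M : measurable_fun [set: R] p -> (\int[leb R]_x (p x ^+ 2)%:E <= M%:E)%E ->
  L1 (fun x => p x ^+ 2) /\ \int[leb R]_x (p x ^+ 2) <= M.
Proof.
move=> mp pM.
have L : L1 (fun x => p x ^+ 2).
  apply/integrableP; split; first by apply/measurable_EFinP; exact: measurable_funX.
  under eq_integral do rewrite /= ger0_norm ?sqr_ge0//.
  exact: le_lt_trans pM (ltry M).
split => //; rewrite -lee_fin /Rintegral fineK//; exact: (integrable_fin_num measurableT L).
Qed.

Let kernel_bound d (k : R -> R) C eta : 0 < eta -> L1 d -> L1 (fun x => d x ^+ 2) ->
  measurable_fun [set: R] k ->
  (forall x, k x ^+ 2 <= C / (1 + x ^+ 2)) -> (forall x, `|k x| <= C) ->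
  \int[leb R]_x (d x ^+ 2) <= eta ^+ 2 ->
  `|\int[leb R]_x (d x * k x)| <= eta * (2^-1 + 2^-1 * \int[leb R]_x (C / (1 + x ^+ 2))).
Proof.
move=> e0 Ld Ld2 mk kC kb dE.
have Ldk := L1M_bounded Ld mk kb.
have LC : L1 (fun x : R => C / (1 + x ^+ 2)) := L1Z C (@L1_cauchy R).
have L2 := L1D (L1Z (2 * eta)^-1 Ld2) (L1Z (eta / 2) LC).
apply: (le_trans (le_normr_Rintegral measurableT Ldk)).
apply: (@le_trans _ _ (\int[leb R]_x ((2 * eta)^-1 * d x ^+ 2 + eta / 2 * (C / (1 + x ^+ 2))))).
  apply: le_Rintegral => //; first exact: L1_norm Ldk.
  move=> x _; apply: (le_trans (young (d x) (k x) e0)).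
  rewrite [_ / (2 * eta)]mulrC lerD2l ler_pM2l ?divr_gt0//.
rewrite (RintegralD measurableT (L1Z (2 * eta)^-1 Ld2) (L1Z (eta / 2) LC)).
rewrite (RintegralZl _ measurableT Ld2) (RintegralZl _ measurableT LC) mulrDr mulrA lerD//.
rewrite mulrC ler_pdivrMr ?mulr_gt0//; apply: (le_trans dE).
suff -> : eta / 2 * (2 * eta) = eta ^+ 2 by [].
by field.
Qed.

(** The integral over [a, b] is that of the approximants minus that of the differences. The
    approximants' transform is L^2-close to g, which vanishes on [a, b]. For the differences, Fubini
    moves the transform onto the indicator, whose transform is square integrable, so L^2-closeness
    of the functions suffices. Everything is O(eta). *)
Lemma rot_local_zero p q a b : L1 p -> L1 q -> a <= b ->
  (forall eta, 0 < eta -> exists p' q' g : R -> R,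
    [/\ L1 p' /\ L1 q', measurable_fun [set: R] g,
        {ae leb R, forall w, `[a, b]%classic w -> g w = 0},
        (\int[leb R]_x ((p' x - p x) ^+ 2)%:E <= (eta ^+ 2)%:E)%E /\
        (\int[leb R]_x ((q' x - q x) ^+ 2)%:E <= (eta ^+ 2)%:E)%E &
        (\int[leb R]_w ((rot p' q' w - g w) ^+ 2)%:E <= (eta ^+ 2)%:E)%E]) ->
  \int[leb R]_(w in `[a, b]) rot p q w = 0.
Proof.
move=> Lp Lq ab H; have [C C0 kC] := kernel_decay ab.
have mg : measurable (`[a, b]%classic : set (measurableTypeR R)) by exact: measurable_itv.
pose N : R := \int[leb R]_t `|ind a b t|.
pose kap2 : R := \int[leb R]_x ((C + N) / (1 + x ^+ 2)).
have N0 : 0 <= N by apply: Rintegral_ge0.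
have k20 : 0 <= kap2.
  by apply: Rintegral_ge0 => x _; rewrite divr_ge0 ?addr_ge0// sqr_ge0.
pose M : R := 2 * (2^-1 + 2^-1 * kap2) + (2^-1 + 2^-1 * (b - a)).
have M0 : 0 < M by rewrite /M; lra.
suff key eta : 0 < eta -> `|\int[leb R]_(w in `[a, b]) rot p q w| <= eta * M.
  apply/eqP; rewrite -normr_eq0 eq_le normr_ge0 andbT; apply/ler_addgt0Pr => e e0.
  by rewrite add0r; have := key (e / M); rewrite divr_gt0// divfK ?gt_eqF//; exact.
move=> e0; have [p' [q' [g [[Lp' Lq'] mgg g0 [dp dq] dr]]]] := H eta e0.
pose d x := p' x - p x; pose e x := q' x - q x.
have Ld : L1 d := L1B Lp' Lp; have Le : L1 e := L1B Lq' Lq.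
have [Ld2 d2] := L1_sqr (L1_measurable Ld) dp.
have [Le2 e2] := L1_sqr (L1_measurable Le) dq.
have mrot u v : L1 u -> L1 v -> measurable_fun [set: R] (rot u v).
  by move=> Lu Lv; apply: continuous_measurable_fun; exact: rot_continuous.
have irot u v : L1 u -> L1 v -> (leb R).-integrable `[a, b] (EFin \o rot u v).
  by move=> Lu Lv; apply: integrable_continuous_itv => w _; exact: rot_continuous.
have [Lr2 r2] := L1_sqr (measurable_funB (mrot _ _ Lp' Lq') mgg) dr.
(* [C] is enlarged to [C + N] because [kernel_bound] wants one constant for both the decay and the
   uniform bound. *)
have kM x : ct (ind a b) (2 * pi * x) ^+ 2 <= (C + N) / (1 + x ^+ 2) /\
            st (ind a b) (2 * pi * x) ^+ 2 <= (C + N) / (1 + x ^+ 2).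
  have [h1 h2] := kC x; have CN : C / (1 + x ^+ 2) <= (C + N) / (1 + x ^+ 2).
    by rewrite ler_pM2r ?lerDl// invr_gt0 ltr_wpDr// sqr_ge0.
  by split; [exact: le_trans h1 CN|exact: le_trans h2 CN].
have mkc : measurable_fun [set: R] (fun x => ct (ind a b) (2 * pi * x)).
  by apply: continuous_measurable_fun; exact: (cont2pi (ct_continuous (L1_ind a b))).
have mks : measurable_fun [set: R] (fun x => st (ind a b) (2 * pi * x)).
  by apply: continuous_measurable_fun; exact: (cont2pi (st_continuous (L1_ind a b))).
have mk (k : R -> R) : continuous k ->
    measurable_fun [set: R * R] (fun z : R * R => k (2 * pi * z.2 * z.1)).
  move=> ck; apply: (measurableT_comp (continuous_measurable_fun ck)).
  by apply: measurable_funM => //; apply: measurable_funM.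
have B1 : `|\int[leb R]_(w in `[a, b]) ct d (2 * pi * w)| <= eta * (2^-1 + 2^-1 * kap2).
  rewrite -indE /ct /ttrans.
  rewrite (Fubini_kernel Ld (L1_ind a b) (mk _ (@continuous_cos R)) (fun=> cos_max _)).
  rewrite (_ : Rintegral _ _ _ = \int[leb R]_x (d x * ct (ind a b) (2 * pi * x))); last first.
    apply: eq_Rintegral => x _; congr (_ * _); apply: eq_Rintegral => w _ /=.
    by rewrite mulrAC.
  apply: kernel_bound => //; first by move=> x; have [] := kM x.
  by move=> x; apply: (le_trans (ct_le _ (L1_ind a b))); rewrite lerDr.
have B2 : `|\int[leb R]_(w in `[a, b]) st e (2 * pi * w)| <= eta * (2^-1 + 2^-1 * kap2).
  rewrite -indE /st /ttrans.
  rewrite (Fubini_kernel Le (L1_ind a b) (mk _ (@continuous_sin R)) (fun=> sin_max _)).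
  rewrite (_ : Rintegral _ _ _ = \int[leb R]_x (e x * st (ind a b) (2 * pi * x))); last first.
    apply: eq_Rintegral => x _; congr (_ * _); apply: eq_Rintegral => w _ /=.
    by rewrite mulrAC.
  apply: kernel_bound => //; first by move=> x; have [] := kM x.
  by move=> x; apply: (le_trans (st_le _ (L1_ind a b))); rewrite lerDr.
have B3 : `|\int[leb R]_(w in `[a, b]) rot p' q' w| <= eta * (2^-1 + 2^-1 * (b - a)).
  apply: (le_trans (le_normr_Rintegral mg (irot _ _ Lp' Lq'))).
  have iu : (leb R).-integrable `[a, b] 
      (EFin \o (fun w => (2 * eta)^-1 * (rot p' q' w - g w) ^+ 2)).
    by apply: integrableS (L1Z (2 * eta)^-1 Lr2).
  have ic : (leb R).-integrable `[a, b] (EFin \o (fun=> eta / 2)).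
    by apply: integrable_continuous_itv => w _; exact: cst_continuous.
  have aeE : {ae leb R, forall w, `[a, b]%classic w ->
      `|rot p' q' w| <= (2 * eta)^-1 * (rot p' q' w - g w) ^+ 2 + eta / 2}.
    apply: ae_imp g0 => w g0w /g0w ->; rewrite subr0.
    by have := young (rot p' q' w) 1 e0; rewrite mulr1 expr1n mulr1 [_ / (2 * eta)]mulrC.
  apply: (@le_trans _ _ (\int[leb R]_(w in `[a, b])
      ((2 * eta)^-1 * (rot p' q' w - g w) ^+ 2 + eta / 2))).
    rewrite /Rintegral fine_le//.
    - by apply: integrable_fin_num => //; exact: integrable_norm (irot _ _ Lp' Lq').
    - by apply: integrable_fin_num => //; exact: integrableD iu ic.
    apply: ae_ge0_le_integral => //.
    - apply/measurable_EFinP; apply: measurable_funTS.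
      by apply: measurableT_comp => //; exact: mrot.
    - move=> w _; rewrite lee_fin addr_ge0//; last by rewrite divr_ge0// ltW.
      by rewrite mulr_ge0 ?sqr_ge0// invr_ge0 mulr_ge0// ltW.
    - exact: measurable_int (integrableD mg iu ic).
  have Ic : \int[leb R]_(w in `[a, b]) (eta / 2) = eta * (2^-1 * (b - a)).
    have dl t : is_derive t (1 : R) (fun t => eta / 2 * t) (eta / 2) by deriv; ring.
    by rewrite (Rintegral_FTC ab dl); [field|exact: cst_continuous].
  rewrite (RintegralD mg iu ic) Ic [leRHS]mulrDr lerD2r.
  apply: (@le_trans _ _ (\int[leb R]_w ((2 * eta)^-1 * (rot p' q' w - g w) ^+ 2))).
    rewrite /Rintegral fine_le//.
    - exact: integrable_fin_num iu.
    - exact: (integrable_fin_num measurableT (L1Z (2 * eta)^-1 Lr2)).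
    apply: ge0_subset_integral => //.
      by apply/measurable_EFinP; exact: (L1_measurable (L1Z (2 * eta)^-1 Lr2)).
    by move=> w _; rewrite lee_fin mulr_ge0 ?sqr_ge0// invr_ge0 mulr_ge0// ltW.
  rewrite (RintegralZl _ measurableT Lr2) mulrC ler_pdivrMr ?mulr_gt0//; apply: (le_trans r2).
  suff -> : eta / 2 * (2 * eta) = eta ^+ 2 by [].
by field.
have ict : (leb R).-integrable `[a, b] (EFin \o (fun w => ct d (2 * pi * w))).
  by apply: integrable_continuous_itv => w _; exact: (cont2pi (ct_continuous Ld)).
have ist : (leb R).-integrable `[a, b] (EFin \o (fun w => st e (2 * pi * w))).
  by apply: integrable_continuous_itv => w _; exact: (cont2pi (st_continuous Le)).
have E : \int[leb R]_(w in `[a, b]) rot p q w = \int[leb R]_(w in `[a, b]) rot p' q' w -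
   (\int[leb R]_(w in `[a, b]) ct d (2 * pi * w) + \int[leb R]_(w in `[a, b]) st e (2 * pi * w)).
  clear B1 B2 B3; rewrite -(RintegralD mg ict ist).
  rewrite -(RintegralB mg (irot _ _ Lp' Lq') (integrableD mg ict ist)).
  apply: eq_Rintegral => w _; rewrite /rot.
  have -> : ct d (2 * pi * w) = ct p' (2 * pi * w) + (-1) * ct p (2 * pi * w).
    by rewrite -(ctD _ _ Lp' Lp); congr (ct _ _); apply/funext => x; rewrite mulN1r.
  have -> : st e (2 * pi * w) = st q' (2 * pi * w) + (-1) * st q (2 * pi * w).
    by rewrite -(stD _ _ Lq' Lq); congr (st _ _); apply/funext => x; rewrite mulN1r.
  by ring.
rewrite E /M; apply: (le_trans (ler_normB _ _)).
rewrite [leRHS]mulrDr [leLHS]addrC; apply: lerD; last exact: B3.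
apply: (le_trans (ler_normD _ _)).
have -> : eta * (2 * (2^-1 + 2^-1 * kap2)) =
  eta * (2^-1 + 2^-1 * kap2) + eta * (2^-1 + 2^-1 * kap2) by ring.
exact: (lerD B1 B2).
Qed.

End band_of_limit.

(** * From complex-valued functions to real and imaginary parts *)

Section complex_valued.
Context (R : realType).
Implicit Types (f g F : R -> R[i]) (u v : R -> R) (x w eta : R).

Local Notation re := (@complex.Re R).
Local Notation im := (@complex.Im R).

Lemma normc_sqr (z : R[i]) : normc z ^+ 2 = re z ^+ 2 + im z ^+ 2.
Proof. by case: z => a b /=; rewrite sqr_sqrtr// addr_ge0// sqr_ge0. Qed.

Lemma normc_ge0 (z : R[i]) : 0 <= normc z.
Proof. by case: z => a b /=; exact: sqrtr_ge0. Qed.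

Lemma re_le_normc (z : R[i]) : `|re z| <= normc z.
Proof.
rewrite -ler_sqr ?nnegrE// ?normc_ge0// normc_sqr real_normK ?num_real//.
by rewrite lerDl sqr_ge0.
Qed.

Lemma im_le_normc (z : R[i]) : `|im z| <= normc z.
Proof.
rewrite -ler_sqr ?nnegrE// ?normc_ge0// normc_sqr real_normK ?num_real//.
by rewrite lerDr sqr_ge0.
Qed.

Lemma reB (z t : R[i]) : re (z - t) = re z - re t.
Proof. by case: z; case: t. Qed.

Lemma imB (z t : R[i]) : im (z - t) = im z - im t.
Proof. by case: z; case: t. Qed.

Lemma reM (z t : R[i]) : re (z * t) = re z * re t - im z * im t.
Proof. by case: z; case: t. Qed.

Lemma imM (z t : R[i]) : im (z * t) = re z * im t + im z * re t.
Proof. by case: z; case: t. Qed.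

Lemma complex_eq (z t : R[i]) : re z = re t -> im z = im t -> z = t.
Proof. by case: z => a b; case: t => c d /= -> ->. Qed.

Lemma cLnorm2E f :
  (cLnorm 2%:E f `^ 2 = \int[leb R]_x (normc (f x) ^+ 2)%:E)%E.
Proof.
rewrite /cLnorm poweR_Lnorm ?pnatr_eq0//; apply: eq_integral => x _.
by rewrite /= ger0_norm ?normc_ge0// -powR_mulrn ?normc_ge0.
Qed.

Lemma cLnorm2_le f eta : (cLnorm 2%:E f <= eta%:E)%E ->
  (\int[leb R]_x (normc (f x) ^+ 2)%:E <= (eta ^+ 2)%:E)%E.
Proof.
rewrite -cLnorm2E; have := Lnorm_ge0 (leb R) 2%:E (fun x => (normc (f x))%:E).
rewrite -/(cLnorm 2%:E f); case: (cLnorm 2%:E f) => //= r.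
rewrite !lee_fin => r0 re_; rewrite (_ : (r `^ 2)%R = r ^+ 2); last by rewrite powR_mulrn.
by rewrite ler_pXn2r// nnegrE// (le_trans r0).
Qed.

Lemma memL2_lty f : (cLnorm 2%:E f < +oo)%E <->
  (\int[leb R]_x (normc (f x) ^+ 2)%:E < +oo)%E.
Proof.
rewrite -cLnorm2E; have := Lnorm_ge0 (leb R) 2%:E (fun x => (normc (f x))%:E).
rewrite -/(cLnorm 2%:E f); case: (cLnorm 2%:E f) => //= [r _|_]; first by rewrite !ltry.
by rewrite pnatr_eq0.
Qed.

Lemma cLnorm2_cvg (F : nat -> R -> R[i]) eta :
  (fun n => cLnorm 2%:E (F n)) @ \oo --> 0%E -> 0 < eta ->
  \forall n \near \oo, (\int[leb R]_x (normc (F n x) ^+ 2)%:E <= (eta ^+ 2)%:E)%E.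
Proof.
move=> /fine_cvgP[Ffin Fcvg] e0; have Fe := cvgr_lt _ Fcvg _ e0.
near=> n; apply: cLnorm2_le.
have Fn : cLnorm 2%:E (F n) \is a fin_num by near: n.
rewrite -(fineK Fn) lee_fin ltW//; near: n; exact: Fe.
Unshelve. all: by end_near. Qed.

Lemma re_sqr_le F : cmeasurable F ->
  (\int[leb R]_x (re (F x) ^+ 2)%:E <= \int[leb R]_x (normc (F x) ^+ 2)%:E)%E.
Proof.
move=> [mr mi]; apply: ge0_le_integral => //.
- by move=> x _; rewrite lee_fin sqr_ge0.
- by apply/measurable_EFinP; exact: measurable_funX.
- apply/measurable_EFinP; under eq_fun do rewrite normc_sqr.
  by apply: measurable_funD; exact: measurable_funX.
- by move=> x _; rewrite lee_fin normc_sqr lerDl sqr_ge0.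
Qed.

Lemma im_sqr_le F : cmeasurable F ->
  (\int[leb R]_x (im (F x) ^+ 2)%:E <= \int[leb R]_x (normc (F x) ^+ 2)%:E)%E.
Proof.
move=> [mr mi]; apply: ge0_le_integral => //.
- by move=> x _; rewrite lee_fin sqr_ge0.
- by apply/measurable_EFinP; exact: measurable_funX.
- apply/measurable_EFinP; under eq_fun do rewrite normc_sqr.
  by apply: measurable_funD; exact: measurable_funX.
- by move=> x _; rewrite lee_fin normc_sqr lerDr sqr_ge0.
Qed.

Lemma memL1_L1 f : memL 1%:E f -> L1 (re \o f) /\ L1 (im \o f).
Proof.
move=> [[mr mi] f1].
have L : L1 (fun x => normc (f x)).
  apply/integrableP; split.
    apply/measurable_EFinP.
    rewrite (_ : (fun x => _) = (fun x => Num.sqrt (re (f x) ^+ 2 + im (f x) ^+ 2))); last first.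
      by apply/funext => x; case: (f x).
    apply: (measurableT_comp (continuous_measurable_fun (@sqrt_continuous R))).
    by apply: measurable_funD; exact: measurable_funX.
  by move: f1; rewrite /cLnorm Lnorm1.
split; apply: L1_le L _ => // x; [exact: re_le_normc|exact: im_le_normc].
Qed.

Lemma re_fourierL1 f w : L1 (re \o f) -> L1 (im \o f) ->
  re (fourierL1 f w) = rot (re \o f) (im \o f) w.
Proof.
move=> Lr Li; rewrite /rot /ct /st /ttrans.
rewrite -(RintegralD measurableT (L1_cos _ Lr) (L1_sin _ Li)).
rewrite /fourierL1 /cintegral /=; apply: eq_Rintegral => x _.
rewrite reM /expi /= cosN sinN (_ : 2 * pi * x * w = 2 * pi * w * x); last by ring.
by ring.
Qed.

Lemma im_fourierL1 f w : L1 (re \o f) -> L1 (im \o f) ->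
  im (fourierL1 f w) = rot (im \o f) (fun x => - re (f x)) w.
Proof.
move=> Lr Li; rewrite /rot /ct /st /ttrans.
have Lr' : L1 (fun x => - re (f x)) by apply: eq_L1 (L1Z (-1) Lr) => x; rewrite mulN1r.
rewrite -(RintegralD measurableT (L1_cos _ Li) (L1_sin _ Lr')).
rewrite /fourierL1 /cintegral /=; apply: eq_Rintegral => x _.
rewrite imM /expi /= cosN sinN (_ : 2 * pi * x * w = 2 * pi * w * x); last by ring.
by ring.
Qed.

Lemma fourierL1_cmeasurable f : L1 (re \o f) -> L1 (im \o f) ->
  cmeasurable (fourierL1 f).
Proof.
move=> Lr Li; have Lr' : L1 (fun x => - re (f x)).
  by apply: eq_L1 (L1Z (-1) Lr) => x; rewrite mulN1r.
split.
- under eq_fun do rewrite re_fourierL1//.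
  by apply: continuous_measurable_fun; exact: rot_continuous.
- under eq_fun do rewrite im_fourierL1//.
  by apply: continuous_measurable_fun; exact: rot_continuous.
Qed.

Lemma cmeasurableB f g : cmeasurable f -> cmeasurable g ->
  cmeasurable (fun x => f x - g x).
Proof.
move=> [fr fi] [gr gi]; split.
- by under eq_fun do rewrite reB; exact: measurable_funB.
- by under eq_fun do rewrite imB; exact: measurable_funB.
Qed.

(** Outside the band, [ess_supp] provides an open neighbourhood on which the L^2 transform g
    vanishes almost everywhere. The sequence defining g supplies the approximants for
    [rot_local_zero] on every small interval, and continuity of the classical transform
    concludes. *)
Lemma bandlimited_rot0 f w : L1 (re \o f) -> L1 (im \o f) -> bandlimited f ->
  1 / 2 < `|w| ->
  rot (re \o f) (im \o f) w = 0 /\ rot (im \o f) (fun x => - re (f x)) w = 0.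
Proof.
move=> Lr Li [g [[mf _] [mg _] [U [mU Uf Ug]]] gsupp] w12.
have Lr' : L1 (fun x => - re (f x)).
  by apply: eq_L1 (L1Z (-1) Lr) => x; rewrite mulN1r.
have : ~ ess_supp g w.
  move=> /gsupp; rewrite /= in_itv /= -ler_norml => w12'.
  by move: (lt_le_trans w12 w12'); rewrite ltxx.
rewrite /ess_supp /= => /contrapT [V /= [oV gV] Vw].
have [d d0 dV] : exists2 d : R, 0 < d & forall x, w - d < x -> x < w + d -> V x.
  have /nbhs_ballP[d d0 dV] : nbhs w V by exact: open_nbhs_nbhs.
  exists d => // x x1 x2; apply: dV; rewrite /ball /= ltr_norml; apply/andP; split; lra.
have H a b eta : w - d < a -> b < w + d -> 0 < eta -> exists n,
   [/\ (\int[leb R]_x (normc (U n x - f x) ^+ 2)%:E <= (eta ^+ 2)%:E)%E,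
       (\int[leb R]_x (normc (fourierL1 (U n) x - g x) ^+ 2)%:E <= (eta ^+ 2)%:E)%E &
       {ae leb R, forall x, `[a, b]%classic x -> g x = 0}].
  move=> wa bw e0; have H1 := cLnorm2_cvg Uf e0; have H2 := cLnorm2_cvg Ug e0.
  near \oo => n; exists n; split; [near: n; exact: H1|near: n; exact: H2|].
  apply: ae_imp gV => x Vx; rewrite /= in_itv /= => /andP[ax xb].
  by apply: Vx; apply: dV; [exact: lt_le_trans ax|exact: le_lt_trans xb _].
split.
- apply: (continuous_itv0 (rot_continuous Lr Li) d0) => a b wa ab bw.
  apply: rot_local_zero => // eta e0; have [n [h1 h2 h3]] := H a b eta wa bw e0.
  have [Lur Lui] := memL1_L1 (mU n).1.
  have mD := cmeasurableB (mU n).1.1 mf.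
  have mE := cmeasurableB (fourierL1_cmeasurable Lur Lui) mg.
  exists (re \o U n), (im \o U n), (re \o g); split => //.
  + exact: mg.1.
  + by apply: ae_imp h3 => x gx /gx /= ->.
  + split.
    * apply: le_trans h1; apply: le_trans (re_sqr_le mD).
      by under [leRHS]eq_integral do rewrite reB.
    * apply: le_trans h1; apply: le_trans (im_sqr_le mD).
      by under [leRHS]eq_integral do rewrite imB.
  + apply: le_trans h2; apply: le_trans (re_sqr_le mE).
    by under [leRHS]eq_integral do rewrite reB re_fourierL1//.
- apply: (continuous_itv0 (rot_continuous Li Lr') d0) => a b wa ab bw.
  apply: rot_local_zero => // eta e0; have [n [h1 h2 h3]] := H a b eta wa bw e0.
  have [Lur Lui] := memL1_L1 (mU n).1.
  have mD := cmeasurableB (mU n).1.1 mf.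
  have mE := cmeasurableB (fourierL1_cmeasurable Lur Lui) mg.
  exists (im \o U n), (fun x => - re (U n x)), (im \o g); split => //.
  + by split => //; apply: eq_L1 (L1Z (-1) Lur) => x; rewrite mulN1r.
  + exact: mg.2.
  + by apply: ae_imp h3 => x gx /gx /= ->.
  + split.
    * apply: le_trans h1; apply: le_trans (im_sqr_le mD).
      by under [leRHS]eq_integral do rewrite imB.
    * apply: le_trans h1; apply: le_trans (re_sqr_le mD).
      rewrite le_eqVlt; apply/orP; left; apply/eqP; apply: eq_integral => x _.
      by congr (_%:E); rewrite reB; ring.
  + apply: le_trans h2; apply: le_trans (im_sqr_le mE).
    by under [leRHS]eq_integral do rewrite imB im_fourierL1//.
Unshelve. all: by end_near. Qed.

(** The transform of a complex function mixes the four real transforms of its parts. Vanishing at x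
    and at - x, where the sines change sign, gives four linear relations that force each of them to
    be zero. *)
Lemma bandlimited_band f : L1 (re \o f) -> L1 (im \o f) -> bandlimited f ->
  band (re \o f) /\ band (im \o f).
Proof.
move=> Lr Li bf; have pi0 := pi_gt0 R.
have cr := ct_continuous Lr; have ci := ct_continuous Li.
have sr := st_continuous Lr; have si := st_continuous Li.
have out w : pi < w -> [/\ ct (re \o f) w = 0, st (re \o f) w = 0,
    ct (im \o f) w = 0 & st (im \o f) w = 0].
  move=> piw; pose x := w / (2 * pi).
  have xE : 2 * pi * x = w by rewrite /x mulrC divfK// gt_eqF// mulr_gt0.
  have x12 : 1 / 2 < x by rewrite /x ltr_pdivlMr ?mulr_gt0//; lra.
  have n1 : 1 / 2 < `|x| by apply: lt_le_trans x12 (ler_norm x).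
  have n2 : 1 / 2 < `|- x| by rewrite normrN.
  have sN : st (fun x => - re (f x)) w = - st (re \o f) w.
    rewrite /st /ttrans -mulN1r -(RintegralZl _ measurableT (L1_sin w Lr)).
    by apply: eq_Rintegral => y _; rewrite /= mulN1r mulNr.
  have [a1 a2] := bandlimited_rot0 Lr Li bf n1.
  have [b1 b2] := bandlimited_rot0 Lr Li bf n2.
  have Lr' : L1 (fun x => - re (f x)).
    by apply: eq_L1 (L1Z (-1) Lr) => y; rewrite mulN1r.
  move: a1 a2 b1 b2; rewrite /rot mulrN xE !ctN (stN _ Li) (stN _ Lr') sN.
  move: (ct _ _) (ct _ _) (st _ _) (st _ _) => p1 p2 p3 p4 ? ? ? ?; split; lra.
split=> w; rewrite le_eqVlt => /predU1P[<-|/out[] //].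
  by split; apply: continuous_right0 => // x /out[].
by split; apply: continuous_right0 => // x /out[].
Qed.

End complex_valued.

(** * Inequality, sharpness and extremizers *)

Section final.
Context (R : realType).
Implicit Types (f : R -> R[i]) (u v : R -> R).

Local Notation re := (@complex.Re R).
Local Notation im := (@complex.Im R).

Lemma weighted_adm f : memL 2%:E f -> bandlimited f ->
  (\int[leb R]_x (normc (f x) ^+ 2 * x ^+ 6)%:E < +oo)%E ->
  adm (re \o f) /\ adm (im \o f).
Proof.
move=> [[mr mi] /memL2_lty f2] bf f6.
have mN : measurable_fun [set: R] (fun x => normc (f x) ^+ 2).
  under eq_fun do rewrite normc_sqr.
  by apply: measurable_funD; exact: measurable_funX.
have mx6 : measurable_fun [set: R] (fun x : R => x ^+ 6).
  by apply: continuous_measurable_fun; exact: exprn_continuous.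
have L0 : L1 (fun x => normc (f x) ^+ 2).
  apply/integrableP; split; first exact/measurable_EFinP.
  by under eq_integral do rewrite /= ger0_norm ?sqr_ge0//.
have L6 : L1 (fun x => normc (f x) ^+ 2 * x ^+ 6).
  apply/integrableP; split; first by apply/measurable_EFinP; exact: measurable_funM.
  apply: le_lt_trans f6; rewrite le_eqVlt; apply/orP; left; apply/eqP.
  apply: eq_integral => x _ /=; rewrite ger0_norm//; apply: mulr_ge0; first exact: sqr_ge0.
  exact: exprn_even_ge0.
have W u : measurable_fun [set: R] u -> (forall x, u x ^+ 2 <= normc (f x) ^+ 2) ->
    L1 (fun x => (1 + x ^+ 6) * u x ^+ 2).
  move=> mu uf; apply: (L1_le _ (L1D L0 L6)).
    apply: measurable_funM; last exact: measurable_funX.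
    by apply: measurable_funD.
  move=> x; have x6 : 0 <= x ^+ 6 by rewrite exprn_even_ge0.
  rewrite ger0_norm; last by apply: mulr_ge0; [exact: addr_ge0|exact: sqr_ge0].
  have -> : normc (f x) ^+ 2 + normc (f x) ^+ 2 * x ^+ 6 = (1 + x ^+ 6) * normc (f x) ^+ 2.
    by ring.
  by apply: ler_wpM2l => //; exact: addr_ge0.
have Wr : L1 (fun x => (1 + x ^+ 6) * re (f x) ^+ 2).
  by apply: W => // x; rewrite normc_sqr lerDl sqr_ge0.
have Wi : L1 (fun x => (1 + x ^+ 6) * im (f x) ^+ 2).
  by apply: W => // x; rewrite normc_sqr lerDr sqr_ge0.
have [Lr Lxr Lxxr] := admP mr Wr; have [Li Lxi Lxxi] := admP mi Wi.
by have [br bi] := bandlimited_band Lr Li bf.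
Qed.

(** Both sides are finite, so their difference may be formed; it is the form at the real part plus
    the form at the imaginary part. *)
Lemma adm_integrals f : adm (re \o f) -> adm (im \o f) ->
  exists A B : R, [/\ (\int[leb R]_x (normc (f x) ^+ 2)%:E = A%:E)%E,
    (\int[leb R]_x (normc (f x) ^+ 2 * x ^+ 6)%:E = B%:E)%E &
    B - A = \int[leb R]_x ((x ^+ 6 - 1) * (re (f x) * re (f x))) +
            \int[leb R]_x ((x ^+ 6 - 1) * (im (f x) * im (f x)))].
Proof.
move=> Ar Ai; have [Lr _ _ Wr _] := Ar; have [Li _ _ Wi _] := Ai.
have W : L1 (fun x => (1 + x ^+ 6) * normc (f x) ^+ 2).
  by apply: eq_L1 (L1D Wr Wi) => x; rewrite normc_sqr mulrDr.
have mN : measurable_fun [set: R] (fun x => normc (f x) ^+ 2).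
  under eq_fun do rewrite normc_sqr.
  by apply: measurable_funD; apply: measurable_funX; exact: L1_measurable.
have L0 : L1 (fun x => normc (f x) ^+ 2).
  apply: (L1_le mN W) => x; rewrite ger0_norm ?sqr_ge0//.
  by rewrite ler_peMl ?sqr_ge0// lerDl exprn_even_ge0.
have L6 : L1 (fun x => normc (f x) ^+ 2 * x ^+ 6).
  by apply: eq_L1 (L1B W L0) => x; ring.
exists (\int[leb R]_x (normc (f x) ^+ 2)), (\int[leb R]_x (normc (f x) ^+ 2 * x ^+ 6)).
split.
- by rewrite /Rintegral fineK//; exact: (integrable_fin_num measurableT L0).
- by rewrite /Rintegral fineK//; exact: (integrable_fin_num measurableT L6).
rewrite -(RintegralB measurableT L6 L0).
rewrite -(RintegralD measurableT (L1_form61 Ar Ar) (L1_form61 Ai Ai)).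
by apply: eq_Rintegral => x _; rewrite normc_sqr; ring.
Qed.

(** Needed for the imaginary part of the extremizer; obtained as [ext] minus itself. *)
Lemma adm0 : adm (fun _ : R => 0 : R).
Proof.
have := admD (-1) (ext_adm R) (ext_adm R).
by congr adm; apply/funext => x; rewrite mulN1r subrr.
Qed.

(** The extremizer lies in both L^1 and L^2, so its classical transform, with the constant sequence,
    represents the L^2 one. That transform is real, equal to [ct ext] at 2 pi w, and vanishes on the
    open set |w| > 1/2. *)
Lemma extremal_bandlimited : bandlimited (@extremal_fun R).
Proof.
have [Le _ _ We _] := ext_adm R; have be := @ext_band R.
have L0 : L1 (fun _ : R => 0 : R) by have [] := adm0.
have me := L1_measurable Le.
have rE : re \o @extremal_fun R = @ext R by [].
have iE : im \o @extremal_fun R = (fun=> 0) by [].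
have st0 w : st (fun _ : R => 0 : R) w = 0.
  by rewrite /st /ttrans; under eq_Rintegral do rewrite mul0r; rewrite Rintegral_cst// mul0r.
have ct0 w : ct (fun _ : R => 0 : R) w = 0.
  by rewrite /ct /ttrans; under eq_Rintegral do rewrite mul0r; rewrite Rintegral_cst// mul0r.
have ste w : st (@ext R) w = 0.
  apply: Rintegral_odd0; first exact: L1_sin.
  by move=> x; rewrite !extE ctN mulrN sinN mulrN.
have FE w : fourierL1 (@extremal_fun R) w = (ct (@ext R) (2 * pi * w))%:C.
  apply: complex_eq; first by rewrite re_fourierL1// rE iE /rot st0 addr0.
  rewrite im_fourierL1// iE /rot ct0 add0r.
  rewrite (_ : (fun x => - re _) = (fun x => (-1) * @ext R x)); last first.
    by apply/funext => x; rewrite mulN1r.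
  have := stD (-1) (2 * pi * w) L0 Le; rewrite st0 ste mulr0 addr0 => stE.
  transitivity (0 : R) => //; rewrite -[RHS]stE.
  by congr (st _ _); apply/funext => x; rewrite add0r.
have pi0 := pi_gt0 R.
have cC : continuous (fun w => ct (@ext R) (2 * pi * w)).
  move=> w; apply: (@cvg_comp _ _ _ (fun w => 2 * pi * w) (ct (@ext R))); last exact: ct_continuous.
  by apply: cvgM; [exact: cvg_cst|exact: cvg_id].
have out w : 1 / 2 < `|w| -> ct (@ext R) (2 * pi * w) = 0.
  move=> w12; have H : pi <= `|2 * pi * w|.
    rewrite normrM gtr0_norm ?mulr_gt0//.
    have -> : 2 * pi * `|w| = pi * (2 * `|w|) by ring.
    by apply: ler_peMr; [exact: ltW|lra].
  by have [] := band_norm Le be H.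
have m2 : memL 2%:E (@extremal_fun R).
  split; first by split => //; exact: measurable_cst.
  apply/memL2_lty; have [A [B [-> _ _]]] := adm_integrals
    (ext_adm R : adm (re \o @extremal_fun R)) (adm0 : adm (im \o @extremal_fun R)).
  exact: ltry.
have m1 : memL 1%:E (@extremal_fun R).
  split; first by split => //; exact: measurable_cst.
  rewrite /cLnorm Lnorm1; have := integrable_lty measurableT (L1_norm Le); apply: le_lt_trans.
  rewrite le_eqVlt; apply/orP; left; apply/eqP; apply: eq_integral => x _ /=.
  by rewrite expr0n /= addr0 sqrtr_sqr normr_id.
exists (fourierL1 (@extremal_fun R)).
  split => //.
    split; first exact: fourierL1_cmeasurable.
    apply/memL2_lty.
    have L2 : L1 (fun w => ct (@ext R) (2 * pi * w) ^+ 2).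
      apply: L1_supp; first by move=> w; apply: cvgM; exact: cC.
      move=> w piw; rewrite out ?expr0n//; apply: lt_le_trans piw.
      by have := pi_ge2 R; lra.
    have := integrable_lty measurableT L2; apply: le_lt_trans.
    rewrite le_eqVlt; apply/orP; left; apply/eqP; apply: eq_integral => w _.
    by rewrite FE normc_sqr /= expr0n addr0.
  exists (fun=> @extremal_fun R); split => //.
  - under eq_fun do under eq_fun do rewrite subrr.
    rewrite (_ : (fun=> _) = (fun=> 0%E)); first exact: cvg_cst.
    apply/funext => _; rewrite /cLnorm (_ : (fun x => _) = cst 0%E) ?Lnorm0//.
    by apply/funext => x; rewrite /= expr0n addr0 sqrtr0.
  - under eq_fun do under eq_fun do rewrite subrr.
    rewrite (_ : (fun=> _) = (fun=> 0%E)); first exact: cvg_cst.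
    apply/funext => _; rewrite /cLnorm (_ : (fun x => _) = cst 0%E) ?Lnorm0//.
    by apply/funext => x; rewrite /= expr0n addr0 sqrtr0.
move=> w; apply: contra_notP; rewrite /= in_itv /= -ler_norml => /negP; rewrite -ltNge => w12.
exists [set x : R | 1 / 2 < `|x|] => //=; split.
  have -> : [set x : R | 1 / 2 < `|x|] = (fun x : R => `|x|) @^-1` [set y | 1 / 2 < y] by [].
  by apply: open_comp; [move=> x _; exact: norm_continuous|exact: open_gt].
apply: aeW => x x12; rewrite FE.
by rewrite out.
Qed.

(** Otherwise [ct ext] would vanish identically, against its nonzero mean. *)
Lemma extremal_not_ae0 : ~ {ae leb R, forall x, @extremal_fun R x = 0}.
Proof.
move=> H; have [Le _ _ _ _] := ext_adm R.
have := ext_mean_neq0 R; rewrite (_ : Rintegral _ _ _ = 0) ?eqxx//.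
transitivity (\int[leb R]_(w in `[0, pi]) (0 : R)); last by rewrite Rintegral_cst// mul0r.
apply: eq_Rintegral => w _; rewrite /ct /ttrans.
transitivity (\int[leb R]_x (0 : R)); last by rewrite Rintegral_cst// mul0r.
rewrite /Rintegral; congr fine; apply: ae_eq_integral => //.
  by apply/measurable_EFinP; exact: (L1_measurable (L1_cos w Le)).
by apply: ae_imp H => x [ex] _; rewrite /ext ex mul0r.
Qed.

Lemma extremal_extremizer : extremizer (@extremal_fun R).
Proof.
have Ae : adm (re \o @extremal_fun R) := ext_adm R.
have A0 : adm (im \o @extremal_fun R) := adm0.
have [[Le _ _ _ _] [L0 _ _ _ _]] := (Ae, A0).
have [A [B [EA EB BA]]] := adm_integrals Ae A0.
split; [|exact: extremal_bandlimited|exact: extremal_not_ae0|].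
  split; first by split; exact: L1_measurable.
  by apply/memL2_lty; rewrite EA ltry.
rewrite EA EB; congr (_%:E); apply/esym/eqP; rewrite -subr_eq0 BA.
rewrite (form_extremal_ortho (ext_adm R) (ext_adm R) (@ext_form R)) add0r.
under eq_Rintegral do rewrite /= mul0r mulr0.
by rewrite Rintegral_cst// mul0r.
Qed.

Lemma sharp_inequality f : memL 2%:E f -> bandlimited f ->
  (\int[leb R]_x (normc (f x) ^+ 2)%:E <= \int[leb R]_x (normc (f x) ^+ 2 * x ^+ 6)%:E)%E.
Proof.
(* An infinite right-hand side is trivial; a finite one places the real and imaginary parts in
   [adm]. *)
move=> f2 bf; have [|f6] := ltP (\int[leb R]_x (normc (f x) ^+ 2 * x ^+ 6)%:E)%E +oo%E; last first.
  exact: le_trans (leey _) f6.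
move=> /(weighted_adm f2 bf)[Ar Ai].
have [A [B [-> -> BA]]] := adm_integrals Ar Ai.
have [Qr _] := form_extremal Ar (ext_adm R) (@ext_form R) (ext_mean_neq0 R).
have [Qi _] := form_extremal Ai (ext_adm R) (@ext_form R) (ext_mean_neq0 R).
by rewrite lee_fin -subr_ge0 BA addr_ge0.
Qed.

Lemma extremizer_unique f : extremizer f ->
  exists c : R[i], {ae leb R, forall x, f x = c * extremal_fun x}.
Proof.
move=> [f2 bf _ E].
have f6 : (\int[leb R]_x (normc (f x) ^+ 2 * x ^+ 6)%:E < +oo)%E.
  by rewrite -E; apply/memL2_lty; exact: f2.2.
have [Ar Ai] := weighted_adm f2 bf f6.
have [A [B [EA EB BA]]] := adm_integrals Ar Ai.
have [Qr Ur] := form_extremal Ar (ext_adm R) (@ext_form R) (ext_mean_neq0 R).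
have [Qi Ui] := form_extremal Ai (ext_adm R) (@ext_form R) (ext_mean_neq0 R).
have AB : B - A = 0 by apply/eqP; rewrite subr_eq0 eq_sym -eqe -EA -EB E.
(* Two nonnegative forms add up to zero, so each vanishes. As the extremizer is real-valued, the two
   real multiples combine into one complex constant. *)
move/eqP: AB; rewrite BA paddr_eq0// => /andP[/eqP /Ur[a Ha] /eqP /Ui[b Hb]].
exists (a +i* b); apply: ae_imp (ae_and Ha Hb) => x [] /=.
rewrite /extremal_fun -/(ext x); case: (f x) => p q /= -> ->.
by apply/eqP; rewrite eq_complex /= !mulr0 subr0 add0r !eqxx.
Qed.

(** At the extremizer both integrals equal the same finite [A], and A > 0 because it is not zero
    almost everywhere; then C A <= A. *)
Lemma sharp_constant (C : R) :
  (forall f : R -> R[i], memL 2%:E f -> bandlimited f ->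
     (C%:E * \int[leb R]_x (normc (f x) ^+ 2)%:E
        <= \int[leb R]_x (normc (f x) ^+ 2 * x ^+ 6)%:E)%E) -> C <= 1.
Proof.
move=> H; have [e2 be e0 E] := extremal_extremizer.
have := H _ e2 be; rewrite -E.
have [A [B [EA _ _]]] := adm_integrals
    (ext_adm R : adm (re \o @extremal_fun R)) (adm0 : adm (im \o @extremal_fun R)).
rewrite EA -EFinM lee_fin.
have A0 : 0 <= A.
  by rewrite -lee_fin -EA; apply: integral_ge0 => x _; rewrite lee_fin sqr_ge0.
suff : A != 0 by move=> An0; rewrite -{2}[A]mul1r ler_pM2r// lt_neqAle eq_sym An0.
apply/eqP => Az; apply: e0.
have me : measurable_fun [set: R] (fun x => (normc (@extremal_fun R x) ^+ 2)%:E).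
  apply/measurable_EFinP; under eq_fun do rewrite normc_sqr.
  by apply: measurable_funD; apply: measurable_funX; [exact: e2.1.1|exact: e2.1.2].
have /(ae_eq_integral_abs (leb R) measurableT me) :
    (\int[leb R]_x `|(normc (@extremal_fun R x) ^+ 2)%:E| = 0)%E.
  rewrite Az in EA; apply: etrans EA; apply: eq_integral => x _.
  by rewrite /= ger0_norm ?sqr_ge0.
apply: ae_imp => x /(_ I) hx.
have /eqP : normc (@extremal_fun R x) ^+ 2 = 0 by case: hx.
rewrite normc_sqr paddr_eq0 ?sqr_ge0// !sqrf_eq0 => /andP[/eqP h1 /eqP h2].
exact: complex_eq.
Qed.

End final.

Theorem corollary1 (R : realType) :
  [/\ (forall f : R -> R[i], memL 2%:E f -> bandlimited f ->
         (\int[leb R]_x (normc (f x) ^+ 2)%:E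
            <= \int[leb R]_x (normc (f x) ^+ 2 * x ^+ 6)%:E)%E),
      (forall C : R,
         (forall f : R -> R[i], memL 2%:E f -> bandlimited f ->
            (C%:E * \int[leb R]_x (normc (f x) ^+ 2)%:E
               <= \int[leb R]_x (normc (f x) ^+ 2 * x ^+ 6)%:E)%E) ->
         C <= 1),
      extremizer (@extremal_fun R) &
      forall f : R -> R[i], extremizer f ->
        exists c : R[i], {ae leb R, forall x, f x = c * extremal_fun x}].
Proof.
split.
- exact: sharp_inequality.
- exact: sharp_constant.
- exact: extremal_extremizer.
- exact: extremizer_unique.
Qed.
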